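(* Let $X$ be a nonempty compact metric space, let $f:X\to X$ be a homeomorphism and let $\psi$ be a continuous flow on $X$. Assume that $h_{\mathrm{top}}(f)<\infty$ and $h_{\mathrm{top}}(\psi)<\infty$. (1) If $f$ is not chain-transitive, then $f$ admits a Hölder continuous potential exhibiting a phase transition; that is, there is a Hölder continuous $\phi:X\to\mathbb{R}$ such that the function $t\mapsto P_{\mathrm{top}}(f,t\phi)$ is not analytic on $\mathbb{R}$. (2) If $\psi$ is not chain-transitive, then $\psi$ admits a Hölder continuous potential exhibiting a phase transition; that is, there is a Hölder continuous $\phi:X\to\mathbb{R}$ such that the function $t\mapsto P_{\mathrm{top}}(\psi,t\phi)$ is not analytic on $\mathbb{R}$.
   Context: A continuous flow on $X$ is a continuous map $\psi:\mathbb{R}\times X\to X$, $\psi_t(x)=\psi(t,x)$, with $\psi(0,x)=x$ and $\psi(s+t,x)=\psi(t,\psi(s,x))$. Chains for homeomorphisms: for $\varepsilon>0$ and $x,y\in X$, an $\varepsilon$-chain from $x$ to $y$ for $f$ is a finite sequence $x=x_0,x_1,\dots,x_n=y$ in $X$ ($n\ge 1$) with $d(f(x_i),x_{i+1})<\varepsilon$ for $i=0,\dots,n-1$. The homeomorphism $f$ is chain-transitive if for all $x,y\in X$ and every $\varepsilon>0$ there is an $\varepsilon$-chain from $x$ to $y$. Chains for flows: for $\varepsilon,T>0$ and $x,y\in X$, an $\varepsilon$-$T$-chain from $x$ to $y$ for $\psi$ consists of points $x=x_0,x_1,\dots,x_n=y$ of $X$ ($n\ge1$) and times $t_0,\dots,t_{n-1}\ge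 T$ with $d(\psi_{t_i}(x_i),x_{i+1})<\varepsilon$ for $i=0,\dots,n-1$. The flow $\psi$ is chain-transitive if for all $x,y\in X$ and all $\varepsilon,T>0$ there is an $\varepsilon$-$T$-chain from $x$ to $y$. Pressure: a potential is a continuous function $\phi:X\to\mathbb{R}$. For a homeomorphism, $P_{\mathrm{top}}(f,\phi)=\sup\{h_\mu(f)+\int\phi\,d\mu\}$, the supremum being over all $f$-invariant Borel probability measures $\mu$, where $h_\mu(f)$ is metric entropy. For a flow, $P_{\mathrm{top}}(\psi,\phi)=\sup\{h_\mu(\psi)+\int\phi\,d\mu\}$ over all $\psi$-invariant Borel probability measures, where $h_\mu(\psi)=h_\mu(\psi_1)$ is the entropy of the time-one map. The topological entropy of the flow is $h_{\mathrm{top}}(\psi)=h_{\mathrm{top}}(\psi_1)$. *)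

(* Defs.v *)
From HB Require Import structures.
From mathcomp Require Import all_boot all_order all_algebra.
From mathcomp Require Import all_classical all_reals all_analysis.

Set Implicit Arguments.
Unset Strict Implicit.
Unset Printing Implicit Defensive.

Import Order.TTheory GRing.Theory Num.Theory.
Import numFieldNormedType.Exports.

Local Open Scope classical_set_scope.
Local Open Scope ring_scope.

(* Nonemptiness of the space is carried by the base point, which the library's
   measurable types require; the base point plays no other role. *)
#[short(type="pmetricType")]
HB.structure Definition PMetric (R : numDomainType) :=
  { X of Metric R X & Pointed X }.

(* The space with its Borel sigma-algebra. *)
Notation borel X := (g_sigma_algebraType (@open X)).

Definition homeomorphism (X : topologicalType) (f : X -> X) : Prop :=
  continuous f /\
  exists g : X -> X, [/\ continuous g, cancel f g & cancel g f].

Definition continuous_flow (R : realType) (X : topologicalType)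
    (psi : R -> X -> X) : Prop :=
  [/\ continuous (fun p : R * X => psi p.1 p.2),
      forall x, psi 0 x = x &
      forall s t x, psi (s + t) x = psi t (psi s x)].

Section chains.
Context (R : realType) (X : metricType R).

Definition eps_chain (f : X -> X) (eps : R) (x y : X) : Prop :=
  exists (n : nat) (u : nat -> X),
    [/\ (0 < n)%N, u 0%N = x, u n = y &
        forall i, (i < n)%N -> mdist (f (u i)) (u i.+1) < eps].

Definition chain_transitive (f : X -> X) : Prop :=
  forall (x y : X) (eps : R), 0 < eps -> eps_chain f eps x y.

Definition flow_eps_chain (psi : R -> X -> X) (eps T : R) (x y : X) : Prop :=
  exists (n : nat) (u : nat -> X) (t : nat -> R),
    [/\ (0 < n)%N, u 0%N = x, u n = y &
        forall i, (i < n)%N ->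
          T <= t i /\ mdist (psi (t i) (u i)) (u i.+1) < eps].

Definition flow_chain_transitive (psi : R -> X -> X) : Prop :=
  forall (x y : X) (eps T : R), 0 < eps -> 0 < T ->
    flow_eps_chain psi eps T x y.

Definition hoelder_continuous (phi : X -> R) : Prop :=
  exists C a : R, [/\ 0 <= C, 0 < a <= 1 &
    forall x y, `|phi x - phi y| <= C * (mdist x y `^ a)].

End chains.

(* Topological entropy by open covers (Adler-Konheim-McAndrew). *)
Section topological_entropy.
Context (R : realType) (X : topologicalType).

Definition open_cover (C : set (set X)) : Prop :=
  (forall U, C U -> open U) /\ \bigcup_(U in C) U = [set: X].

(* Least cardinality of a finite subcover; the set of such cardinalities is
   nonempty when the space is compact. *)
Definition cover_number (C : set (set X)) : R :=
  inf [set n%:R | n in [set n : nat | exists u : 'I_n -> set X,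
    (forall i, C (u i)) /\ \bigcup_i u i = [set: X]]].

(* C \/ f^-1 C \/ ... \/ f^-(n-1) C *)
Definition join_cover (f : X -> X) (C : set (set X)) (n : nat) : set (set X) :=
  [set A | exists w : 'I_n -> set X, (forall i, C (w i)) /\
    A = [set x | forall i : 'I_n, w i (iter i f x)]].

(* The limit exists for every continuous f and open cover C of a compact
   space, by subadditivity. *)
Definition htop_cover (f : X -> X) (C : set (set X)) : R :=
  limn (fun n : nat => ln (cover_number (join_cover f C n)) / n%:R).

Definition htop (f : X -> X) : \bar R :=
  ereal_sup [set (htop_cover f C)%:E | C in open_cover].

End topological_entropy.
Arguments htop {R X} f.

Section metric_entropy.
Context (R : realType) (d : measure_display) (T : measurableType d).
Variables (mu : probability T R) (f : T -> T).

Definition measurable_partition (k : nat) (xi : 'I_k -> set T) : Prop :=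
  partition setT xi [set: T] /\ forall i, measurable (xi i).

(* Shannon entropy of xi \/ f^-1 xi \/ ... \/ f^-(n-1) xi, whose blocks are
   indexed by words w (possibly with empty blocks, which contribute 0 since
   0 * ln 0 = 0). *)
Definition join_entropy (k : nat) (xi : 'I_k -> set T) (n : nat) : R :=
  \sum_(w : {ffun 'I_n -> 'I_k})
    let p := fine (mu [set x | forall i : 'I_n, xi (w i) (iter i f x)]) in
    - (p * ln p).

(* The limit exists when mu is f-invariant, by subadditivity. *)
Definition partition_entropy (k : nat) (xi : 'I_k -> set T) : R :=
  limn (fun n : nat => join_entropy xi n / n%:R).

Definition metric_entropy : \bar R :=
  ereal_sup [set h | exists (k : nat) (xi : 'I_k -> set T),
    measurable_partition xi /\ h = (partition_entropy xi)%:E].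

Definition invariant_measure : Prop :=
  forall A, measurable A -> mu (f @^-1` A) = mu A.

End metric_entropy.

Section pressure.
Context (R : realType) (X : pmetricType R).

Definition pressure (f : X -> X) (phi : X -> R) : \bar R :=
  ereal_sup [set (metric_entropy mu f + \int[mu]_x (phi x)%:E)%E |
    mu in [set mu : probability (borel X) R | invariant_measure mu f]].

Definition flow_pressure (psi : R -> X -> X) (phi : X -> R) : \bar R :=
  ereal_sup [set (metric_entropy mu (psi 1%R) + \int[mu]_x (phi x)%:E)%E |
    mu in [set mu : probability (borel X) R |
             forall t, invariant_measure mu (psi t)]].

Definition flow_htop (psi : R -> X -> X) : \bar R := htop (psi 1).

End pressure.

Definition real_analytic (R : realType) (F : R -> R) : Prop :=
  forall t0 : R, exists (a : nat -> R) (r : R), 0 < r /\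
    forall h : R, `|h| < r -> pseries a h @ \oo --> F (t0 + h).

(* Main.v *)
(** If the dynamics is not chain-transitive, the set [U] of points reachable by
chains from some point is open, is not the whole space, and absorbs the
[eps]-neighbourhood of its own image. An invariant measure therefore does not
charge the part of [U] outside that image, and a Lipschitz function that is 0
on the image and 1 off [U] integrates to the mass [p] of the complement of [U].
Splitting a measure along [U] shows that its entropy is at most
[(1 - p) a + p C], where [a] is the supremum of the entropies of the measures
carried by [U] and [C] is a uniform bound on entropy. So the pressure of [t phi]
is constantly [a] for [t <= - C], whereas it is at least [t] because some
invariant measure is carried by the complement of [U]; an analytic function
cannot behave like that.

The bound [C] comes from comparing a partition with an open cover built from
closed subsets of its blocks. The two invariant measures come from an
ultrafilter limit of orbit averages, a finitely additive mean on all subsets,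
which induces a Borel measure through its inner values on open sets. *)

From HB Require Import structures.
Require Import Defs.
From mathcomp Require Import all_boot all_order all_algebra.
From mathcomp Require Import all_classical all_reals all_analysis.
From mathcomp Require Import measurable_realfun.
From mathcomp Require Import lra zify ring.

Set Implicit Arguments.
Unset Strict Implicit.
Unset Printing Implicit Defensive.

Import Order.TTheory GRing.Theory Num.Theory.
Import numFieldNormedType.Exports.

Local Open Scope classical_set_scope.
Local Open Scope ring_scope.

(** * Subadditive sequences and the identity theorem *)

(** The set [U] is only forward invariant, and for a flow only under times at least [T]. Since [U]
    and its preimage have the same mass, it is nevertheless invariant up to a null set, which is
    what lets an invariant measure be conditioned on [U] and on its complement. For a flow, every
    time is a difference of two times at least [T], so invariance under the latter is enough. The
    mean of an orbit may give an open set mass that the limit measure places on its boundary. Full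
    measure is therefore proved through a closed subset that catches the orbit; the gap [eps]
    supplies one, the closure of the image of [U]. The forward orbit of a point of [U] then gives a
    measure carried by [U], and the backward orbit of an unreachable point gives one carried by the
    complement. The constant [C] is the topological entropy plus [ln 2 + 1]: a crude form of the
    variational inequality whose loss depends neither on the measure nor on the partition. *)

(** Fekete's argument: dividing [n] by a fixed [k.+1] with remainder bounds [u n / n] by
    [u k.+1 / k.+1] up to a multiple of [1 / n], so the limit is the infimum over positive indices.
    This turns the [limn] in the definitions of entropy into genuine limits. *)
Lemma subadditive_is_cvg (R : realType) (u : nat -> R) :
  (forall n, 0 <= u n) -> (forall m n, u (m + n)%N <= u m + u n) ->
  cvgn (fun n => u n / n%:R).
Proof.
move=> u0 uD.
pose S := [set u n.+1 / n.+1%:R | n in [set: nat]].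
have S0 : S !=set0 by exists (u 1%N / 1); exists 0%N.
have Slb : lbound S 0 by move=> _ [n _ <-]; rewrite divr_ge0.
have Sinf : has_inf S by split => //; exists 0.
have uM q k : u (q * k)%N <= q%:R * u k + u 0%N.
  elim: q => [|q IH]; first by rewrite mul0n mul0r add0r.
  by rewrite mulSn (le_trans (uD _ _))// -natr1 mulrDl mul1r; lra.
apply/cvg_ex; exists (inf S); apply/cvgrPdist_le => e e0.
have e20 : 0 < e / 2 by rewrite divr_gt0.
have [_ [k _ <-] kS] := @inf_adherent _ S (e / 2) e20 Sinf.
(* [B] dominates [u 0] plus any remainder term, independently of [n]. *)
pose B := u 0%N + \sum_(i < k.+1) u i.
have B0 : 0 <= B by rewrite addr_ge0// sumr_ge0.
near=> n.
have n0 : (0 < n)%N by near: n; exists 1%N.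
have nR0 : 0 < n%:R :> R by rewrite ltr0n.
have Sn : inf S <= u n / n%:R.
  by apply: ge_inf; [exists 0|exists n.-1 => //; rewrite prednK].
rewrite ler_distlC lerBlDr (le_trans Sn) ?lerDl ?(ltW e0)//=.
have un : u n <= (n %/ k.+1)%:R * u k.+1 + B.
  rewrite {1}(divn_eq n k.+1) (le_trans (uD _ _))//.
  have r : u (n %% k.+1)%N <= \sum_(i < k.+1) u i.
    have lt : (n %% k.+1 < k.+1)%N by rewrite ltn_mod.
    by rewrite (bigD1 (Ordinal lt))//= lerDl sumr_ge0.
  by have := uM (n %/ k.+1)%N k.+1; rewrite /B; lra.
have q : (n %/ k.+1)%:R <= n%:R / k.+1%:R :> R.
  by rewrite ler_pdivlMr ?ltr0n// -natrM ler_nat leq_trunc_div.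
have Bn : B / n%:R <= e / 2.
  rewrite ler_pdivrMr// mulrC -ler_pdivrMr//.
  by near: n; exact: nbhs_infty_ger.
have : u n / n%:R <= u k.+1 / k.+1%:R + B / n%:R.
  rewrite ler_pdivrMr// mulrDl divfK ?gt_eqF//.
  apply: (le_trans un); rewrite lerD2r.
  rewrite (_ : u k.+1 / _ * _ = n%:R / k.+1%:R * u k.+1); last by ring.
  by rewrite ler_wpM2r.
move=> /le_trans; apply; rewrite [e]splitr addrA.
by apply: lerD Bn; exact: ltW.
Unshelve. all: by end_near.
Qed.

Lemma sum_expr_le2 (R : realFieldType) (s : R) m n : 0 <= s <= 2^-1 ->
  \sum_(m <= i < n) s ^+ i <= 2 * s ^+ m.
Proof.
move=> /andP[s0 s2].
have [nm|mn] := leqP n m; first by rewrite big_geq// mulr_ge0// exprn_ge0.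
have -> : 2 * s ^+ m = s ^+ m / 2^-1 by rewrite invrK mulrC.
rewrite ler_pdivlMr// (@le_trans _ _ ((\sum_(m <= i < n) s ^+ i) * (1 - s)))//.
  by rewrite ler_wpM2l ?sumr_ge0// => [i _|]; [exact: exprn_ge0|lra].
have -> : (\sum_(m <= i < n) s ^+ i) * (1 - s) = s ^+ m - s ^+ n.
  rewrite big_distrl/= -[RHS]opprB -(@telescope_sumr _ _ _ (fun i => s ^+ i) (ltnW mn)).
  by rewrite -sumrN; apply: eq_bigr => i _; rewrite exprSr; ring.
by rewrite gerBl exprn_ge0.
Qed.

(** If [a k] is the first nonzero coefficient, then at [h = - h0 * s] its term has size [c * s ^+ k]
    while the tail is at most [2 * M * s ^+ k.+1]. The sum being zero, [c <= 2 * M * s] for all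
    small [s], which fails near 0. Only negative [h] are used, because below the function is known
    on one side of a point only. *)
Lemma pseries_zero_left (R : realType) (a : nat -> R) (r : R) : 0 < r ->
  (forall h, - r < h < 0 -> pseries a h @ \oo --> (0 : R)) -> forall n, a n = 0.
Proof.
move=> r0 ah; apply: (well_founded_ind Wf_nat.lt_wf) => k IH.
apply/eqP/contraT => ak0; exfalso.
pose h0 := r / 2; have h00 : 0 < h0 by rewrite divr_gt0.
have [M [M0 Mb]] : exists M, 0 < M /\ forall n, `|a n| * h0 ^+ n <= M.
  have /ah c : - r < - h0 < 0 by rewrite /h0; apply/andP; split; lra.
  have : cvgn (pseries a (- h0)) by apply/cvg_ex; exists 0.
  move=> /cvg_series_cvg_0/cvgP/cvg_seq_bounded[M [Mr Mb]].
  exists (`|M| + 1); split; first by rewrite ltr_wpDl.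
  move=> n; have := Mb (`|M| + 1) (ltr_pwDr ltr01 (ler_norm M)) n I.
  by rewrite /= normrM normrX normrN (ger0_norm (ltW h00)).
pose c := `|a k| * h0 ^+ k.
have c0 : 0 < c by rewrite mulr_gt0 ?normr_gt0 ?exprn_gt0.
suff H s : 0 < s <= 2^-1 -> c <= 2 * M * s.
  have /H : 0 < Num.min 2^-1 (c / (4 * M)) <= 2^-1.
    by rewrite lt_min ge_min lexx invr_gt0 ltr0n divr_gt0// mulr_gt0.
  apply/negP; rewrite -ltNge (@le_lt_trans _ _ (2 * M * (c / (4 * M))))//.
    by rewrite ler_wpM2l ?ge_min ?lexx ?orbT// mulr_ge0// ltW.
  by have -> : 2 * M * (c / (4 * M)) = c / 2; [field; rewrite gt_eqF|lra].
move=> /andP[s0 s2]; pose x := h0 * s.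
have x0 : 0 <= x by rewrite mulr_ge0// ltW.
have cx := ah (- x); have {cx} cx : pseries a (- x) @ \oo --> (0 : R).
  apply: cx; have : h0 * s <= h0 * 2^-1 by rewrite ler_wpM2l// ltW.
  have : 0 < h0 * s by rewrite mulr_gt0.
  by rewrite /x /h0 => ? ?; apply/andP; split; lra.
suff : c * s ^+ k <= 2 * M * s * s ^+ k by rewrite ler_pM2r// exprn_gt0.
apply/ler_addgt0Pr => e e0.
have /cvgrPdist_lt/(_ e e0)[N _ Ne] := cx.
have /= := Ne (maxn N k.+1) (leq_maxl _ _).
set n := maxn N k.+1; rewrite sub0r normrN /pseries /series/=.
rewrite (big_cat_nat (n:=k))//=; last by rewrite ltnW// leq_max ltnSn orbT.
rewrite big_nat big1 ?add0r => [|i ik]; last by rewrite IH ?mul0r//; apply/ssrnat.ltP.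
rewrite big_ltn; last by rewrite leq_max ltnSn orbT.
set t := \sum_(_ <= _ < _) _ => le.
have te : `|t| <= M * (2 * s ^+ k.+1).
  apply: le_trans (_ : M * \sum_(k.+1 <= i < n) s ^+ i <= _); last first.
    by rewrite ler_wpM2l ?(ltW M0)// sum_expr_le2// ltW.
  rewrite mulr_sumr (le_trans (ler_norm_sum _ _ _))// ler_sum// => i _.
  rewrite normrM normrX normrN (ger0_norm x0) /x [(h0 * s) ^+ _]exprMn mulrA.
  by rewrite ler_wpM2r// exprn_ge0// ltW.
have cE : c * s ^+ k = `|a k * (- x) ^+ k|.
  by rewrite /c normrM normrX normrN (ger0_norm x0) /x [(h0 * s) ^+ _]exprMn mulrA.
have := ler_normB (a k * (- x) ^+ k + t) t; rewrite addrK -cE.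
by move: te le; rewrite exprS; set z := s ^+ k; set w := `|_ + t|; lra.
Qed.

(** Expand [F] at the supremum of the [s] up to which [F] equals [a]: the values on the left
    determine all coefficients, so [F] still equals [a] slightly beyond the supremum. *)
Lemma real_analytic_cst (R : realType) (F : R -> R) (a t1 : R) :
  real_analytic F -> (forall t, t <= t1 -> F t = a) -> forall t, F t = a.
Proof.
move=> Fan Fa t; apply: contrapT => Fta.
pose S := [set s | forall t, t <= s -> F t = a].
have S1 : S t1 by [].
have Sub : ubound S t.
  by move=> s Ss; rewrite leNgt; apply/negP => /ltW/Ss.
have Ssup : has_sup S by split; [exists t1|exists t].
have Flt u : u < sup S -> F u = a.
  move=> us; have := @sup_adherent _ S (sup S - u); rewrite subr_gt0 us.
  by move=> /(_ isT Ssup)[v Sv]; rewrite opprB addrC subrK => /ltW/Sv.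
have [b [r [r0 Fb]]] := Fan (sup S).
(* The coefficients of [F - a]; only the constant one changes. *)
pose b' n := if n is 0%N then b 0%N - a else b n.
have b'E h n : pseries b' h n.+1 = pseries b h n.+1 - a.
  rewrite /pseries /series/= !big_nat_recl//= expr0 !mulr1.
  by rewrite [RHS]addrAC; congr (_ + _).
have b'cvg h : `|h| < r -> pseries b' h @ \oo --> F (sup S + h) - a.
  move=> hr; rewrite -cvg_shiftS; under eq_fun do rewrite b'E.
  by apply: cvgB; [rewrite cvg_shiftS; exact: Fb|exact: cvg_cst].
have b'0 : forall n, b' n = 0.
  apply: (@pseries_zero_left _ _ r) => // h /andP[rh h0].
  have := b'cvg h; rewrite Flt ?subrr; last by rewrite gtrDl.
  by apply; rewrite ltr0_norm//; lra.
have FS h : `|h| < r -> F (sup S + h) = a.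
  move=> /b'cvg; rewrite (_ : pseries b' h = cst 0).
    move=> /(cvg_unique (@Rhausdorff R) (cvg_cst 0))/esym/eqP.
    by rewrite subr_eq0 => /eqP.
  by apply/funext => n; rewrite /pseries /series/= big1// => i _; rewrite b'0 mul0r.
have : sup S + r / 2 <= sup S.
  apply: ub_le_sup; first by exists t.
  move=> u ur; have [/Flt//|Su] := ltP u (sup S).
  have -> : u = sup S + (u - sup S) by rewrite addrC subrK.
  by apply: FS; rewrite ger0_norm ?subr_ge0//; lra.
by apply/negP; rewrite -ltNge ltrDl divr_gt0.
Qed.

(** * Shannon entropy of joins *)

(** Gibbs' inequality, termwise from [ln (1 + x) <= x]. The third hypothesis guards against the
    convention [ln 0 = 0], under which a zero of [q] would cost nothing. Both entropy estimates
    below apply it, with [q] a model for the law of words. *)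
Lemma gibbs (R : realType) (I : finType) (p q : I -> R) :
  (forall i, 0 <= p i) -> (forall i, 0 <= q i) ->
  (forall i, 0 < p i -> 0 < q i) ->
  \sum_i p i = 1 -> \sum_i q i <= 1 ->
  \sum_i - (p i * ln (p i)) <= \sum_i - (p i * ln (q i)).
Proof.
move=> p0 q0 pq p1 q1.
suff H i : - (p i * ln (p i)) <= - (p i * ln (q i)) + (q i - p i).
  apply: (le_trans (ler_sum _ (fun i _ => H i))).
  by rewrite big_split/= sumrB p1; lra.
have := p0 i; rewrite le_eqVlt => /predU1P[<-|pi0].
  by rewrite !mul0r oppr0 add0r addr0.
have qi0 := pq i pi0.
have : ln (1 + (q i / p i - 1)) <= q i / p i - 1.
  by apply: le_ln1Dx; rewrite ltrBrDr addNr divr_gt0.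
rewrite addrC subrK ln_div ?posrE// -(ler_pM2l pi0) !mulrBr mulr1.
by rewrite mulrCA divff ?gt_eqF// mulr1; lra.
Qed.

Section words.
Context (R : realType) (d : measure_display) (T : measurableType d).
Variables (mu : probability T R) (f : T -> T) (mf : measurable_fun setT f).
Variables (k : nat) (xi : 'I_k -> set T) (xiP : measurable_partition xi).

Definition cylinder n (w : {ffun 'I_n -> 'I_k}) : set T :=
  [set x | forall i : 'I_n, xi (w i) (iter i f x)].

Lemma measurable_iter n : measurable_fun setT (fun x => iter n f x).
Proof.
elim: n => [|n IH]; first exact: measurable_id.
exact: (measurableT_comp mf IH).
Qed.

Lemma measurable_iter_preimage n (A : set T) :
  measurable A -> measurable [set x | A (iter n f x)].
Proof.
by move=> mA; rewrite -[X in measurable X]setTI; exact: measurable_iter.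
Qed.

Lemma measurable_cylinder n (w : {ffun 'I_n -> 'I_k}) : measurable (cylinder w).
Proof.
rewrite (_ : cylinder w = \bigcap_(i in [set: 'I_n])
    [set x | xi (w i) (iter i f x)]).
  apply: fin_bigcap_measurable => // i _.
  by apply: measurable_iter_preimage; apply: xiP.2.
by apply/seteqP; split => x /= h; [move=> i _; exact: h|move=> i; exact: h].
Qed.

Lemma cylinder_trivIset n : trivIset setT (@cylinder n).
Proof.
apply/trivIsetP => v w _ _ /eqP vw; rewrite -subset0 => x [xv xw]; apply: vw.
apply/ffunP => i; have [[_ tr _] _] := xiP.
by apply: (tr (v i) (w i)) => //; exists (iter i f x).
Qed.

Lemma bigcup_cylinder n : \bigcup_(w in setT) @cylinder n w = setT.
Proof.
have [[cov _ _] _] := xiP; apply/seteqP; split => // x _.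
have /choice[c xc] : forall y, exists i, xi i y.
  by move=> y; have : [set: T] y by []; rewrite -cov => -[i _ ?]; exists i.
by exists [ffun i : 'I_n => c (iter i f x)] => // i; rewrite ffunE.
Qed.

Lemma fine_mu_sum (I : finType) (A : set T) (B : I -> set T) : measurable A ->
  (forall i, measurable (B i)) -> trivIset setT B -> \bigcup_i B i = setT ->
  fine (mu A) = \sum_i fine (mu (A `&` B i)).
Proof.
move=> mA mB tB cB; rewrite -{1}(setIT A) -cB setI_bigcupr.
rewrite measure_fin_bigcup//=; last 2 first.
- exact/trivIset_setIl.
- by move=> i _; exact: measurableI.
rewrite (_ : [set: I] = [set` xpredT])%classic; last by apply/seteqP; split.
rewrite -(@bigfs _ _ _ _ (index_enum I)) ?index_enum_uniq//; last first.
  by move=> i _; rewrite mem_index_enum.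
rewrite -sum_fine// => i _; apply: fin_num_measure; exact: measurableI.
Qed.

Definition cyl_mass n (w : {ffun 'I_n -> 'I_k}) : R := fine (mu (cylinder w)).

Lemma join_entropyE n :
  join_entropy mu f xi n = \sum_w - (@cyl_mass n w * ln (cyl_mass w)).
Proof. by []. Qed.

Lemma cyl_mass_ge0 n w : 0 <= @cyl_mass n w.
Proof. by rewrite fine_ge0. Qed.

Lemma sum_cyl_massI n (A : set T) : measurable A ->
  fine (mu A) = \sum_w fine (mu (A `&` @cylinder n w)).
Proof.
move=> mA; apply: fine_mu_sum => //.
- exact: measurable_cylinder.
- exact: cylinder_trivIset.
- exact: bigcup_cylinder.
Qed.

Lemma sum_cyl_mass n : \sum_w @cyl_mass n w = 1.
Proof.
under eq_bigr do rewrite /cyl_mass -[cylinder _]setTI.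
by rewrite -sum_cyl_massI// probability_setT.
Qed.

Lemma join_entropy_ge0 n : 0 <= join_entropy mu f xi n.
Proof.
rewrite join_entropyE sumr_ge0// => w _; rewrite -mulrN mulr_ge0 ?cyl_mass_ge0//.
rewrite oppr_ge0 ln_le0// -(sum_cyl_mass n) (bigD1 w)//= lerDl sumr_ge0// => v _.
exact: cyl_mass_ge0.
Qed.

Hypothesis finv : invariant_measure mu f.

Lemma invariant_iter n (A : set T) : measurable A ->
  mu [set x | A (iter n f x)] = mu A.
Proof.
move=> mA; elim: n => [//|n IH].
rewrite -IH -[RHS]finv; last exact: measurable_iter_preimage.
by congr (mu _); apply/seteqP; split => x; rewrite /= -iterSr.
Qed.

(** Gibbs' inequality compares the law of words of length [m + n] with the product of the laws of
    prefix and suffix. The logarithm of the product splits the right side into the entropies of the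
    two marginals; by invariance a suffix read from time [m] has the law of a word read from time
    0. *)
Lemma join_entropyD m n :
  join_entropy mu f xi (m + n) <= join_entropy mu f xi m + join_entropy mu f xi n.
Proof.
pose l (w : {ffun 'I_(m + n) -> 'I_k}) : {ffun 'I_m -> 'I_k} :=
  [ffun i => w (lshift n i)].
pose r (w : {ffun 'I_(m + n) -> 'I_k}) : {ffun 'I_n -> 'I_k} :=
  [ffun i => w (rshift m i)].
pose glue (v : {ffun 'I_m -> 'I_k} * {ffun 'I_n -> 'I_k}) :
    {ffun 'I_(m + n) -> 'I_k} :=
  [ffun i => match fintype.split i with inl j => v.1 j | inr j => v.2 j end].
have glueK : cancel glue (fun w => (l w, r w)).
  case=> v1 v2; congr pair; apply/ffunP => i; rewrite !ffunE /=.
    by rewrite (unsplitK (inl i : 'I_m + 'I_n)%type).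
  by rewrite (unsplitK (inr i : 'I_m + 'I_n)%type).
have glueK' : cancel (fun w => (l w, r w)) glue.
  by move=> w; apply/ffunP => i; rewrite !ffunE; case: fintype.splitP => j ij;
    rewrite ffunE; congr (w _); apply/val_inj; rewrite /= ij.
have cylE w : cylinder w = cylinder (l w) `&` [set x | cylinder (r w) (iter m f x)].
  have iterDC j x : iter (m + j) f x = iter j f (iter m f x).
    by rewrite addnC iterD.
  apply/seteqP; split => x /=.
    move=> h; split=> i; rewrite ffunE; first exact: h.
    by rewrite -iterDC; exact: (h (rshift m i)).
  move=> [hl hr] i; rewrite -(splitK i); case: (fintype.split i) => j /=.
    by have := hl j; rewrite ffunE.
  by have := hr j; rewrite ffunE -iterDC.
pose q w := cyl_mass (l w) * cyl_mass (r w).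
have q1 : \sum_w q w = 1.
  rewrite (reindex glue) /=; last by exists (fun w => (l w, r w)) => w _.
  rewrite (eq_bigr (fun v => cyl_mass v.1 * cyl_mass v.2)); last first.
    by case=> v1 v2 _; rewrite /q; have /= [-> ->] := glueK (v1, v2).
  rewrite -(pair_big xpredT xpredT (fun v1 v2 => cyl_mass v1 * cyl_mass v2))/=.
  under eq_bigr do rewrite -mulr_sumr sum_cyl_mass mulr1.
  exact: sum_cyl_mass.
have pl w : cyl_mass w <= cyl_mass (l w).
  rewrite fine_le ?fin_num_measure//; try exact: measurable_cylinder.
  apply: le_measure; rewrite ?inE; try exact: measurable_cylinder.
  by rewrite cylE => x [].
have pr w : cyl_mass w <= cyl_mass (r w).
  rewrite /cyl_mass -(invariant_iter m (measurable_cylinder (r w))).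
  have mr : measurable [set x | cylinder (r w) (iter m f x)].
    by apply: measurable_iter_preimage; exact: measurable_cylinder.
  rewrite fine_le ?fin_num_measure//; try exact: measurable_cylinder.
  apply: le_measure; rewrite ?inE//; try exact: measurable_cylinder.
  by rewrite cylE => x [].
rewrite join_entropyE; apply: le_trans (@gibbs _ _ _ q _ _ _ _ _) _.
- exact: cyl_mass_ge0.
- by move=> w; rewrite mulr_ge0// cyl_mass_ge0.
- by move=> w p0; rewrite mulr_gt0// (lt_le_trans p0).
- exact: sum_cyl_mass.
- by rewrite q1.
(* [g] is the prefix or the suffix map *)
have massI j (g : {ffun 'I_(m + n) -> 'I_k} -> {ffun 'I_j -> 'I_k})
    (v : {ffun 'I_j -> 'I_k}) (Z : {ffun 'I_j -> 'I_k} -> set T) :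
    (forall v, measurable (Z v)) -> trivIset setT Z ->
    (forall w, cylinder w `<=` Z (g w)) ->
    fine (mu (Z v)) = \sum_(w | g w == v) cyl_mass w.
  move=> mZ tZ cZ; rewrite (@sum_cyl_massI (m + n))// [RHS]big_mkcond/=.
  apply: eq_bigr => w _; case: eqP => [<-|/eqP gwv].
    by congr (fine (mu _)); apply/setIidPr/cZ.
  rewrite (_ : _ `&` _ = set0) ?measure0//; rewrite -subset0 => x [Zv /cZ Zw].
  by move/trivIsetP : tZ => /(_ _ _ I I gwv); rewrite -subset0; apply.
have lnq w : - (cyl_mass w * ln (q w)) =
    - (cyl_mass w * ln (cyl_mass (l w))) - cyl_mass w * ln (cyl_mass (r w)).
  have := cyl_mass_ge0 w; rewrite le_eqVlt => /predU1P[<-|p0].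
    by rewrite !mul0r oppr0 addr0.
  by rewrite /q lnM ?posrE ?(lt_le_trans p0)// mulrDr opprD.
rewrite (eq_bigr _ (fun w _ => lnq w)) big_split/=; apply: lerD.
- rewrite join_entropyE (partition_big l xpredT)//= ler_sum// => v _.
  rewrite (eq_bigr (fun w => cyl_mass w * - ln (cyl_mass v))); last first.
    by move=> w /eqP <-; rewrite mulrN.
  rewrite -mulr_suml mulrN; rewrite le_eqVlt; apply/predU1P; left; congr (- (_ * _)).
  rewrite -(massI _ l v (@cylinder m)) //; first exact: measurable_cylinder.
    exact: cylinder_trivIset.
  by move=> w; rewrite cylE => x [].
- rewrite join_entropyE (partition_big r xpredT)//= ler_sum// => v _.
  rewrite (eq_bigr (fun w => cyl_mass w * - ln (cyl_mass v))); last first.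
    by move=> w /eqP <-; rewrite mulrN.
  rewrite -mulr_suml mulrN; rewrite le_eqVlt; apply/predU1P; left; congr (- (_ * _)).
  rewrite -[RHS]/(fine (mu (cylinder v))) -(invariant_iter m (measurable_cylinder v)).
  rewrite -(massI _ r v (fun v => [set x | cylinder v (iter m f x)])) //.
  - by move=> ?; apply: measurable_iter_preimage; exact: measurable_cylinder.
  - apply/trivIsetP => v1 v2 _ _ v12.
    have /trivIsetP/(_ _ _ I I v12) := @cylinder_trivIset n.
    by rewrite -!subset0 => h x; exact: (h (iter m f x)).
  - by move=> w; rewrite cylE => x [].
Qed.

Lemma partition_entropy_cvg :
  (fun n => join_entropy mu f xi n / n%:R) @ \oo --> partition_entropy mu f xi.
Proof.
exact: (subadditive_is_cvg join_entropy_ge0 join_entropyD).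
Qed.

Lemma partition_entropy_ge0 : 0 <= partition_entropy mu f xi.
Proof.
apply: limr_ge; first exact: (subadditive_is_cvg join_entropy_ge0 join_entropyD).
by apply: nearW => n; rewrite divr_ge0// join_entropy_ge0.
Qed.

End words.

(** * Cover numbers *)

Section cover_numbers.
Context (R : realType) (X : pmetricType R).
Hypothesis Xcompact : compact [set: X].

Lemma cover_number_le (I : finType) (u : I -> set X) (C : set (set X)) :
  (forall i, C (u i)) -> \bigcup_i u i = [set: X] ->
  cover_number R C <= #|I|%:R.
Proof.
move=> Cu cu; apply: ge_inf; first by exists 0 => _ [n _ <-].
exists #|I| => //; exists (u \o enum_val); split=> [i|]; first exact: Cu.
apply/seteqP; split => // x _; have : [set: X] x by [].
by rewrite -cu => -[i _ ux]; exists (enum_rank i) => //=; rewrite enum_rankK.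
Qed.

(** The infimum runs over natural numbers, so it is a minimum as soon as compactness makes the set
    nonempty. Positivity of [n] comes from the base point. *)
Lemma cover_number_attained (C : set (set X)) : open_cover C ->
  exists (n : nat) (u : 'I_n -> set X), [/\ (0 < n)%N, forall i, C (u i),
    \bigcup_i u i = [set: X] & cover_number R C = n%:R].
Proof.
move=> [oC cC].
pose P n := exists u : 'I_n -> set X,
  (forall i, C (u i)) /\ \bigcup_i u i = [set: X].
have exP : exists n, `[< P n >].
  have := Xcompact; rewrite compact_cover => /(_ (set X) C id oC).
  rewrite /cover cC => /(_ (fun=> id))[D DC cD].
  pose s := finmap.enum_fset D.
  exists (size s); apply/asboolP; exists (fun i => nth set0 s i); split.
    by move=> i; apply/set_mem/DC; exact: (mem_nth set0 (ltn_ord i)).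
  apply/seteqP; split => // x _; have [A DA Ax] := cD x I.
  have Ds : (index A s < size s)%N by rewrite index_mem.
  by exists (Ordinal Ds) => //=; rewrite nth_index.
case: (ex_minnP exP) => n /asboolP[u [Cu cu]] nmin.
exists n, u; split => //.
  rewrite lt0n; apply/eqP => n0; move: u Cu cu; rewrite n0 => u _ cu.
  by have : [set: X] point by []; rewrite -cu => -[i]; case: i.
apply/eqP; rewrite eq_le; apply/andP; split.
  by rewrite -[in leRHS](card_ord n); exact: cover_number_le cu.
by apply: lb_le_inf; [exists n%:R, n => //; exists u|
  move=> _ [m Pm <-]; rewrite ler_nat nmin//; exact/asboolP].
Qed.

Lemma cover_number_ge1 (C : set (set X)) : open_cover C -> 1 <= cover_number R C.
Proof. by move=> /cover_number_attained[n [u [n0 _ _ ->]]]; rewrite ler1n. Qed.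

Variables (f : X -> X) (cf : continuous f) (C : set (set X)).
Hypothesis oC : open_cover C.

Lemma continuous_iter n : continuous (fun x => iter n f x).
Proof.
elim: n => [|n IH] x; first exact: cvg_id.
exact: (continuous_comp (IH x) (@cf (iter n f x))).
Qed.

Lemma join_cover_open n : open_cover (join_cover f C n).
Proof.
split=> [A [w [Cw ->]]|].
  rewrite openE => x wx; apply: filter_forall => i.
  apply: (@continuous_iter i x); apply: open_nbhs_nbhs; split; last exact: wx.
  exact: oC.1.
apply/seteqP; split => // x _.
have /choice[c xc] : forall y, exists A, C A /\ A y.
  by move=> y; have : [set: X] y by []; rewrite -oC.2 => -[A]; exists A.
exists [set y | forall i : 'I_n, c (iter i f x) (iter i f y)].
  by exists (fun i => c (iter i f x)); split => // i; exact: (xc _).1.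
by move=> i; exact: (xc _).2.
Qed.

Lemma cover_number_joinD m n :
  cover_number R (join_cover f C (m + n)) <=
  cover_number R (join_cover f C m) * cover_number R (join_cover f C n).
Proof.
have [a [u [_ /choice[wu uE] cu ->]]] := cover_number_attained (join_cover_open m).
have [b [v [_ /choice[wv vE] cv ->]]] := cover_number_attained (join_cover_open n).
rewrite -natrM -[X in (X * _)%N]card_ord -[X in (_ * X)%N]card_ord -card_prod.
pose w (p : 'I_a * 'I_b) (i : 'I_(m + n)) :=
  match fintype.split i with inl j => wu p.1 j | inr j => wv p.2 j end.
apply: (cover_number_le (u := fun p => [set x | forall i, w p i (iter i f x)])).
  move=> [i j]; exists (w (i, j)); split => // l; rewrite /w.
  by case: fintype.splitP => l' _; [exact: (uE i).1|exact: (vE j).1].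
have iterDC j x : iter (m + j) f x = iter j f (iter m f x).
  by rewrite addnC iterD.
apply/seteqP; split => // x _.
have : [set: X] x by []; rewrite -cu => -[i _].
rewrite (uE i).2 => /= xi.
have : [set: X] (iter m f x) by []; rewrite -cv => -[j _].
rewrite (vE j).2 => /= xj.
exists (i, j) => // l; rewrite /w; case: fintype.splitP => l' ll'; rewrite ll'.
  exact: xi.
by rewrite iterDC; exact: xj.
Qed.

Let lnN n := ln (cover_number R (join_cover f C n)).

Lemma htop_cover_cvg : (fun n => lnN n / n%:R) @ \oo --> htop_cover R f C.
Proof.
apply: (@subadditive_is_cvg _ lnN) => [n|m n].
  by rewrite ln_ge0// cover_number_ge1//; exact: join_cover_open.
have pos k : cover_number R (join_cover f C k) \is Num.pos.
  by rewrite posrE (lt_le_trans ltr01)// cover_number_ge1//; exact: join_cover_open.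
rewrite -lnM// ler_ln ?cover_number_joinD//.
by rewrite posrE mulr_gt0// -posrE.
Qed.

Lemma htop_cover_le_htop : ((htop_cover R f C)%:E <= htop f)%E.
Proof. by apply: ereal_sup_ubound; exists C. Qed.

End cover_numbers.

(** * Regularity of Borel probabilities *)

Lemma increasing_union_approx (R : realType) d (T : measurableType d)
    (mu : probability T R) (F : nat -> set T) (e : R) :
  (forall n, measurable (F n)) -> nondecreasing_seq F -> 0 < e ->
  exists n, (mu (\bigcup_n F n `\` F n) <= e%:E)%E.
Proof.
move=> mF ndF e0; have mU : measurable (\bigcup_n F n) by exact: bigcup_measurable.
have fin A : measurable A -> mu A \is a fin_num by exact: fin_num_measure.
have : mu \o F @ \oo --> (fine (mu (\bigcup_n F n)))%:E.
  by rewrite fineK ?fin//; exact: nondecreasing_cvg_mu.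
move=> /fine_cvgP[_ /cvgrPdist_le/(_ e e0)[n _ /(_ n (leqnn n))]] /= le.
exists n; rewrite measureD// ?ltey_eq ?fin//.
rewrite (_ : _ `&` F n = F n); last by apply/setIidPr => x Fx; exists n.
apply: (@le_trans _ _ ((fine (mu (\bigcup_n F n)))%:E - (fine (mu (F n)))%:E)%E).
  by rewrite !fineK ?fin.
by rewrite -EFinB lee_fin; exact: le_trans (ler_norm _) le.
Qed.

Section erosion.
Context (R : realType) (X : metricType R).

(** Closed sets that exhaust an open [U] from inside. Testing each point outside [U] separately
    avoids a distance to a possibly empty complement. *)
Definition erosion (U : set X) (n : nat) : set X :=
  [set x | forall y, ~ U y -> n.+1%:R^-1 <= mdist x y].

Lemma closed_erosion U n : closed (erosion U n).
Proof.
rewrite -[erosion U n]setCK; apply: open_closedC; rewrite openE => x.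
move=> /existsNP[y /not_implyP[Uy /negP]]; rewrite -ltNge => xy.
have d0 : 0 < n.+1%:R^-1 - mdist x y by rewrite subr_gt0.
apply: filterS (nbhsx_ballx x _ d0) => z; rewrite ballEmdist /= => xz Kz.
have := Kz y Uy; apply/negP; rewrite -ltNge.
apply: le_lt_trans (metric_triangle z x y) _.
by rewrite (metric_sym z x) -ltrBrDr.
Qed.

Lemma erosion_sub U n : erosion U n `<=` U.
Proof.
move=> x Kx; apply: contrapT => Ux; have := Kx x Ux.
by rewrite mdistxx leNgt invr_gt0 ltr0n.
Qed.

Lemma nondecreasing_erosion U : nondecreasing_seq (erosion U).
Proof.
move=> m n mn; apply/subsetPset => x Kx y /Kx; apply: le_trans.
by rewrite lef_pV2 ?posrE// ler_nat ltnS.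
Qed.

(** Stated for [x'] and [n] jointly, the form in which the near-covering characterisation of
    compactness will use it. *)
Lemma near_erosion U x : open U -> U x ->
  \forall x' \near x & n \near \oo, erosion U n x'.
Proof.
move=> oU Ux; have /nbhs_ballP[r /= r0 rU] := open_nbhs_nbhs (conj oU Ux).
have r20 : 0 < r / 2 by rewrite divr_gt0.
exists (ball x (r / 2), [set n | n.+1%:R^-1 < r / 2]) => /=.
  by split; [exact: nbhsx_ballx|exact: near_infty_natSinv_lt (PosNum r20)].
move=> [x' n] /= [xx' nr] y Uy; apply: (le_trans (ltW nr)); rewrite leNgt.
apply/negP => xy; apply: Uy; apply: rU; rewrite [r]splitr.
by apply: ball_triangle xx' _; rewrite ballEmdist.
Qed.

Lemma bigcup_erosion U : open U -> \bigcup_n erosion U n = U.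
Proof.
move=> oU; apply/seteqP; split => [x [n _ /erosion_sub]//|x Ux].
have [[A B] /= [Ax [N _ NB]] AB] := near_erosion oU Ux.
by exists N => //; apply: (AB (x, N)); split => /=; [exact: nbhs_singleton|exact: (NB N (leqnn N))].
Qed.

End erosion.

Section regularity.
Context (R : realType) (X : pmetricType R) (mu : probability (borel X) R).

(** Bounding the mass of the gap between [K] and [G] makes the notion symmetric under complement, so
    that the regular sets form a sigma-algebra. *)
Definition regular_set (A : set X) := forall e : R, 0 < e ->
  exists K G : set X, [/\ closed K, open G, K `<=` A, A `<=` G &
    (mu (G `\` K) <= e%:E)%E].

Lemma open_borel (A : set X) : open A -> measurable (A : set (borel X)).
Proof. by move=> oA; exact: sub_sigma_algebra. Qed.

Lemma closed_borel (A : set X) : closed A -> measurable (A : set (borel X)).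
Proof.
by move=> cA; rewrite -[A]setCK; apply: measurableC; apply: open_borel; exact: closed_openC.
Qed.

Lemma regular_open (U : set X) : open U -> regular_set U.
Proof.
move=> oU e e0.
have mE n : measurable (erosion U n : set (borel X)).
  by apply: closed_borel; exact: closed_erosion.
have [n le] := increasing_union_approx mu mE (@nondecreasing_erosion _ _ U) e0.
exists (erosion U n), U; split => //; [exact: closed_erosion|exact: erosion_sub|].
by rewrite -{1}(bigcup_erosion oU).
Qed.

Lemma regular_setC (A : set X) : regular_set A -> regular_set (~` A).
Proof.
move=> rA e /rA[K [G [cK oG KA AG le]]]; exists (~` G), (~` K); split.
- exact: open_closedC.
- exact: closed_openC.
- exact: subsetC.
- exact: subsetC.
- by rewrite setDE setCK setIC -setDE.
Qed.

Lemma regular_bigcup (A : nat -> set X) :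
  (forall n, regular_set (A n)) -> regular_set (\bigcup_n A n).
Proof.
move=> rA e e0; have e20 : 0 < e / 2 by rewrite divr_gt0.
have /choice[KG KGP] : forall n, exists KG : set X * set X,
    [/\ closed KG.1, open KG.2, KG.1 `<=` A n, A n `<=` KG.2 &
      (mu (KG.2 `\` KG.1) <= (e / 2 / (2 ^ n.+1)%:R)%:E)%E].
  move=> n; have p : 0 < e / 2 / (2 ^ n.+1)%:R by rewrite divr_gt0// ltr0n expn_gt0.
  by have [K [G ?]] := rA n _ p; exists (K, G).
pose K n := (KG n).1; pose G n := (KG n).2.
have mK n : measurable (K n : set (borel X)).
  by apply: closed_borel; have [] := KGP n.
have mG n : measurable (G n : set (borel X)).
  by apply: open_borel; have [] := KGP n.
(* The union of all [K n] need not be closed, so only finitely many are kept. One half of [e] pays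
   for those left out, the other half for the gaps between [K n] and [G n]. *)
pose L n := \bigcup_(i < n) K i.
have cL n : closed (L n).
  by apply: closed_bigcup => [|i _]; [exact: finite_II|have [] := KGP i].
have ndL : nondecreasing_seq L.
  by move=> m n mn; apply/subsetPset => x [i /= im Kx]; exists i => //=; exact: leq_trans mn.
have UL : \bigcup_n L n = \bigcup_n K n.
  apply/seteqP; split => x; first by move=> [n _ [i _ Kx]]; exists i.
  by move=> [n _ Kx]; exists n.+1 => //; exists n => /=.
have [N leN] := increasing_union_approx mu (fun n => closed_borel (cL n)) ndL e20.
exists (L N), (\bigcup_n G n); split => //.
- by apply: bigcup_open => n _; have [] := KGP n.
- by move=> x [i _ Kx]; exists i => //; have [_ _ + _ _] := KGP i; apply.
- by apply: subset_bigcup => i _; have [] := KGP i.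
have mUK : measurable (\bigcup_n K n : set (borel X)) by exact: bigcup_measurable.
have mUG : measurable (\bigcup_n G n : set (borel X)) by exact: bigcup_measurable.
have mLN : measurable (L N : set (borel X)) by exact: closed_borel.
have mGK n : measurable (G n `\` K n : set (borel X)) by exact: measurableD.
have mUGK : measurable (\bigcup_n (G n `\` K n) : set (borel X)).
  exact: bigcup_measurable.
have mUKL : measurable (\bigcup_n K n `\` L N : set (borel X)).
  exact: measurableD.
apply: (@le_trans _ _ (mu ((\bigcup_n (G n `\` K n)) `|`
    (\bigcup_n K n `\` L N) : set (borel X)))).
  apply: le_measure; rewrite ?inE; [exact: measurableD|exact: measurableU|].
  move=> x [[n _ Gx] Lx]; have [UKx|UKx] := pselect ((\bigcup_n K n) x).
    by right.
  by left; exists n => //; split => // Kx; apply: UKx; exists n.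
rewrite [e]splitr EFinD (le_trans (measureU2 _ _ _))// leeD//; last first.
  by rewrite -UL.
apply: le_trans (epsilon_trick0 xpredT (ltW e20)).
apply: (le_trans (measure_sigma_subadditive _ mGK mUGK _)) => //.
by apply: lee_nneseries => // n _; have [_ _ _ _ le] := KGP n; exact: le.
Qed.

Lemma regular_borel (A : set (borel X)) : measurable A -> regular_set A.
Proof.
suff : <<s @open X >> `<=` regular_set by apply.
apply: smallest_sub => [|U]; last exact: regular_open.
split=> [|B rB|B rB].
- by apply: regular_open; exact: open0.
- by rewrite setTD; exact: regular_setC.
- exact: regular_bigcup.
Qed.

End regularity.

(** * A uniform bound on metric entropy *)

(** The pointwise bound is integrated over [D]. The number [a] may have either sign: it will be
    minus a logarithm, corrected by constants. *)
Lemma measure_count_le (R : realType) d (T : measurableType d)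
    (mu : probability T R) (n : nat) (E : 'I_n -> set T) (D : set T) (a c : R) :
  measurable D -> (forall i, measurable (E i)) -> 0 <= c ->
  (forall x, D x -> a <= \sum_(i < n) c * \1_(E i) x) ->
  a * fine (mu D) <= c * \sum_(i < n) fine (mu (D `&` E i)).
Proof.
move=> mD mE c0 aE; have fin A : measurable A -> mu A \is a fin_num by exact: fin_num_measure.
have [a0|/ltW a0] := leP 0 a; last first.
  apply: (@le_trans _ _ 0); first by rewrite mulr_le0_ge0// fine_ge0.
  by rewrite mulr_ge0// sumr_ge0// => i _; exact: fine_ge0.
have : (\int[mu]_(x in D) a%:E <=
    \int[mu]_(x in D) (\sum_(i < n) (c * \1_(E i) x)%:E))%E.
  apply: ge0_le_integral => //.
  - apply: emeasurable_sum => i; apply/measurable_EFinP.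
    by apply: measurable_funM => //; exact: measurable_indic.
  - by move=> x Dx; rewrite sumEFin lee_fin aE.
rewrite integral_cst// ge0_integral_sum//; last 2 first.
- move=> i; apply/measurable_EFinP.
  by apply: measurable_funM => //; exact: measurable_indic.
- by move=> i x _; rewrite lee_fin mulr_ge0.
rewrite (eq_bigr (fun i => (c * fine (mu (D `&` E i)))%:E)); last first.
  move=> i _; rewrite integralZl_indic//; last by rewrite ltNge c0.
  rewrite integral_indic// EFinM fineK; last by apply: fin; exact: measurableI.
  by rewrite setIC.
rewrite sumEFin (_ : (a%:E * _ = (a * fine (mu D))%:E)%E) ?lee_fin ?mulr_sumr//.
by rewrite EFinM fineK ?fin.
Qed.

Section entropy_bound.
Context (R : realType) (X : pmetricType R) (mu : probability (borel X) R).
Variable f : X -> X.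
Hypotheses (Xcompact : compact [set: X]) (cf : continuous f).
Hypothesis finv : invariant_measure mu f.

Lemma continuous_borel (g : X -> X) : continuous g ->
  measurable_fun [set: borel X] (g : borel X -> borel X).
Proof.
move=> cg; apply: (@measurability _ _ (borel X) (borel X) setT g (@open X)) => //.
move=> _ [U oU <-]; rewrite setTI; apply: open_borel.
by apply: open_comp => // x _; exact: cg.
Qed.

Variables (k : nat) (xi : 'I_k -> set (borel X)) (xiP : measurable_partition xi).

Lemma measurable_partition_gt0 : (0 < k)%N.
Proof.
case: k xi xiP => // xi0 [[cov _ _] _].
by have : [set: X] point by []; rewrite -cov => -[i]; case: i.
Qed.

Variables (K : 'I_k -> set X) (Kcl : forall i, closed (K i)).
Hypothesis Kxi : forall i, K i `<=` xi i.

(** As each [K j] lies in [xi j], this is the union of [K i] and [off_kernel]: an open set whose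
    points lie in the block [xi i], except for points off all kernels. *)
Definition kernel_hull (i : 'I_k) : set X :=
  [set x | forall j, j != i -> ~ K j x].

Definition off_kernel : set X := [set x | forall j, ~ K j x].

Lemma xi_inj x i j : xi i x -> xi j x -> i = j.
Proof.
have [[_ tr _] _] := xiP.
by move=> xix xjx; apply: (tr i j) => //; exists x.
Qed.

Lemma ex_xi x : exists i, xi i x.
Proof.
have [[cov _ _] _] := xiP.
by have : [set: X] x by []; rewrite -cov => -[i]; exists i.
Qed.

Lemma open_kernel_hull : open_cover (range kernel_hull).
Proof.
split=> [_ [i _ <-]|].
  rewrite openE => x xi'; apply: filter_forall => j; have [->|ji] := eqVneq j i.
    exact: nearW.
  have : nbhs x (~` K j).
    apply: open_nbhs_nbhs; split; [exact: closed_openC|exact: xi'].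
  by apply: filterS => y Kjy _.
apply/seteqP; split => // x _; have [i xix] := ex_xi x.
exists (kernel_hull i); first by exists i.
by move=> j ji /Kxi xjx; move: ji; rewrite (xi_inj xjx xix) eqxx.
Qed.

Lemma kernel_hull_xi i j x : kernel_hull i x -> xi j x -> j != i -> off_kernel x.
Proof.
move=> hx xjx ji l Kl; have [li|li] := eqVneq l i; last exact: hx Kl.
by move: ji; rewrite -li (xi_inj xjx (Kxi Kl)) eqxx.
Qed.

Lemma measurable_off_kernel : measurable (off_kernel : set (borel X)).
Proof.
rewrite (_ : off_kernel = ~` \bigcup_i K i).
  apply: measurableC; apply: fin_bigcup_measurable => // i _.
  exact: closed_borel.
by apply/seteqP; split => x /= h; [move=> [i _]; exact: h|move=> i Ki; apply: h; exists i].
Qed.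

Let mf : measurable_fun [set: borel X] (f : borel X -> borel X) := continuous_borel cf.

(** Gibbs' inequality with this model of words: pick one of the [N] words of a minimal subcover
    uniformly, then at each position independently copy its letter with probability 1/2 or draw a
    uniform letter. An orbit that follows the chosen word has an itinerary differing from it only at
    visits to [off_kernel]. Hence [- ln q] is at most [ln N + n * ln 2] plus [ln k] per visit, and
    by invariance the expected number of visits is [n] times the mass of [off_kernel]. *)
Lemma join_entropy_le_cover n :
  join_entropy mu f xi n <=
  ln (cover_number R (join_cover f (range kernel_hull) n)) +
  n%:R * (ln 2 + ln k%:R * fine (mu off_kernel)).
Proof.
have k0 : 0 < k%:R :> R by rewrite ltr0n measurable_partition_gt0.
have k1 : 1 <= k%:R :> R by rewrite ler1n measurable_partition_gt0.
have lnk0 : 0 <= ln k%:R :> R by rewrite ln_ge0.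
have [N [u [N0 /choice[V uV] cu ->]]] :=
  cover_number_attained Xcompact (join_cover_open cf open_kernel_hull n).
have NR0 : 0 < N%:R :> R by rewrite ltr0n.
have /choice[sw swE] : forall s, exists t : 'I_n -> 'I_k,
    u s = [set x | forall i : 'I_n, kernel_hull (t i) (iter i f x)].
  move=> s; have [/(_ _)/cid2 VV us] := uV s.
  have /choice[t tE] : forall i, exists j, kernel_hull j = V s i.
    by move=> i; have [j _ ?] := (uV s).1 i; exists j.
  by exists t; rewrite us; apply/seteqP; split => x h i; have := h i; rewrite tE.
(* One letter of the model: half a point mass at [s], half the uniform law. *)
pose c (s j : 'I_k) : R := (2 * k%:R)^-1 + (j == s)%:R / 2.
have c0 s j : 0 < c s j.
  by rewrite /c ltr_wpDr ?divr_ge0// invr_gt0 mulr_gt0.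
pose q (w : {ffun 'I_n -> 'I_k}) := N%:R^-1 * \sum_(s < N) \prod_i c (sw s i) (w i).
have q1 : \sum_w q w = 1.
  rewrite -mulr_sumr exchange_big/= (eq_bigr (fun=> 1)).
    by rewrite sumr_const card_ord mulVf// gt_eqF.
  move=> s _; rewrite -(bigA_distr_bigA (fun i j => c (sw s i) j)) big1// => i _.
  rewrite /c big_split/= sumr_const card_ord -mulr_suml (bigD1 (sw s i))//= eqxx.
  rewrite big1 => [|j /negbTE ->//]; rewrite addr0 mul1r -[_ *+ k]mulr_natr.
  by field; rewrite gt_eqF.
have qw (w : {ffun 'I_n -> 'I_k}) s : N%:R^-1 * \prod_i c (sw s i) (w i) <= q w.
  rewrite ler_wpM2l ?invr_ge0 ?(ltW NR0)//; rewrite [leRHS](bigD1 s)//= lerDl sumr_ge0// => t _.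
  by rewrite prodr_ge0// => i _; exact: ltW.
have q0 w : 0 < q w.
  apply: lt_le_trans (qw w (Ordinal N0)).
  by rewrite mulr_gt0 ?invr_gt0// prodr_gt0.
pose E i := [set x | off_kernel (iter i f x)].
have mE i : measurable (E i : set (borel X)).
  by apply: (measurable_iter_preimage mf); exact: measurable_off_kernel.
(* on a cylinder each step costs [ln 2], plus [ln k] when the orbit leaves the kernels *)
have lnq (w : {ffun 'I_n -> 'I_k}) (x : X) : cylinder (T := borel X) f xi w x ->
    - ln (q w) - ln N%:R - n%:R * ln 2 <= \sum_(i < n) ln k%:R * \1_(E i) x.
  move=> wx; have : [set: X] x by []; rewrite -cu => -[s _]; rewrite swE => sx.
  have cE (i : 'I_n) : expR (- (ln 2 + ln k%:R * \1_(E i) x)) <= c (sw s i) (w i).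
    have [wi|wi] := eqVneq (w i) (sw s i).
      apply: (@le_trans _ _ 2^-1).
        rewrite expRN lef_pV2 ?posrE ?expR_gt0// expRD lnK ?posrE//.
        by rewrite ler_peMr// -[leLHS]expR0 ler_expR mulr_ge0.
      by rewrite /c wi eqxx mul1r lerDr invr_ge0 mulr_ge0// ltW.
    have -> : \1_(E i) x = 1 :> R.
      by rewrite indicE mem_set//; exact: (kernel_hull_xi (sx i) (wx i)).
    by rewrite mulr1 expRN expRD !lnK ?posrE// /c (negbTE wi) mul0r addr0.
  have : N%:R^-1 * expR (\sum_(i < n) - (ln 2 + ln k%:R * \1_(E i) x)) <= q w.
    apply: le_trans (qw w s); rewrite ler_wpM2l ?invr_ge0 ?(ltW NR0)//.
    by rewrite expR_sum ler_prod// => i _; rewrite expR_ge0 cE.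
  rewrite -ler_ln ?posrE ?q0// ?mulr_gt0 ?invr_gt0 ?expR_gt0//.
  rewrite [ln (_ * expR _)]lnM ?posrE ?invr_gt0 ?expR_gt0// lnV ?posrE// expRK sumrN big_split/=.
  by rewrite sumr_const card_ord -mulr_natl; lra.
have H : forall w : {ffun 'I_n -> 'I_k}, - (cyl_mass mu f xi w * ln (q w)) <=
    cyl_mass mu f xi w * (ln N%:R + n%:R * ln 2) +
    ln k%:R * \sum_(i < n) fine (mu (E i `&` cylinder (T := borel X) f xi w)).
  move=> w; have := measure_count_le mu (measurable_cylinder mf xiP w) (fun i : 'I_n => mE i) lnk0 (lnq w).
  under eq_bigr do rewrite setIC.
  by rewrite /cyl_mass; lra.
apply: (le_trans (gibbs (q := q) _ _ _ _ _)).
- exact: cyl_mass_ge0.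
- by move=> w; exact: ltW.
- by [].
- exact: sum_cyl_mass.
- by rewrite q1.
apply: (le_trans (ler_sum _ (fun w _ => H w))).
rewrite big_split/= -mulr_suml (sum_cyl_mass mu mf xiP) mul1r -mulr_sumr exchange_big/=.
rewrite (eq_bigr (fun=> fine (mu off_kernel))) => [|i _]; last first.
  rewrite -(sum_cyl_massI mu mf xiP)//; congr fine.
  by apply: (invariant_iter mf finv); exact: measurable_off_kernel.
by rewrite sumr_const card_ord -mulr_natl; lra.
Qed.

End entropy_bound.

(** In the comparison with a cover, the cost [ln k] times the mass of [off_kernel] is brought below
    1 by taking the kernels large enough in terms of the number of blocks. What remains is
    independent of the partition. The loss [ln 2 + 1] is harmless where only a uniform finite bound
    is wanted. *)
Lemma metric_entropy_le_htop (R : realType) (X : pmetricType R)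
    (mu : probability (borel X) R) (f : X -> X) :
  compact [set: X] -> continuous f -> invariant_measure mu f ->
  (@htop R X f < +oo)%E ->
  (metric_entropy mu f <= (fine (@htop R X f) + ln 2 + 1)%:E)%E.
Proof.
move=> Xc cf finv hf; apply: ge_ereal_sup => _ [k [xi [xiP ->]]]; rewrite lee_fin.
have k0 := measurable_partition_gt0 xiP.
have kR0 : 0 < k%:R :> R by rewrite ltr0n.
(* Each of the [k] blocks misses at most [1 / k ^ 2], so [off_kernel] has mass at most [1 / k], and
   [ln k <= k]. *)
pose e := (k%:R ^+ 2)^-1 : R; have e0 : 0 < e by rewrite invr_gt0 exprn_gt0.
have /choice[K KP] : forall i, exists K : set X,
    [/\ closed K, K `<=` xi i & (mu (xi i `\` K) <= e%:E)%E].
  move=> i; have [K [G [cK oG KA AG le]]] := regular_borel mu (xiP.2 i) e0.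
  exists K; split => //; apply: le_trans le; apply: le_measure; rewrite ?inE.
  - by apply: measurableD; [exact: xiP.2|exact: closed_borel].
  - by apply: measurableD; [exact: open_borel|exact: closed_borel].
  - by move=> x [/AG].
have Kcl i : closed (K i) by have [] := KP i.
have Kxi i : K i `<=` xi i by have [] := KP i.
have mK0 := measurable_off_kernel Kcl.
have lnk : ln k%:R * fine (mu (off_kernel K)) <= 1.
  have : fine (mu (off_kernel K)) <= k%:R^-1.
    have [[cov tr _] mxi] := xiP.
    rewrite (@fine_mu_sum _ _ _ mu _ _ xi)//.
    apply: (@le_trans _ _ (\sum_(i < k) e)).
      apply: ler_sum => i _; have [_ _ le] := KP i.
      have m1 : measurable (xi i `\` K i : set (borel X)).
        by apply: measurableD => //; exact: closed_borel.
      have m2 : measurable (off_kernel K `&` xi i : set (borel X)).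
        exact: measurableI.
      rewrite -lee_fin fineK ?fin_num_measure//; apply: le_trans le.
      by apply: le_measure; rewrite ?inE// => x [K0 xix]; split => //; exact: K0.
    rewrite sumr_const card_ord -[leLHS]mulr_natr /e expr2 invfM -mulrA mulVf ?mulr1//.
    by rewrite gt_eqF.
  move=> /(ler_wpM2l (ln_ge0 _)) => /(_ k%:R); rewrite ler1n => /(_ k0) le.
  apply: (le_trans le); rewrite ler_pdivrMr// mul1r ltW// ln_sublinear//.
have oC := open_kernel_hull xiP Kcl Kxi.
have hC := htop_cover_cvg Xc cf oC.
have mf := continuous_borel cf.
have hle : htop_cover R f (range (kernel_hull K)) <= fine (@htop R X f).
  by move: (htop_cover_le_htop f oC) hf; case: (htop f) => [r| |]//; rewrite lee_fin.
rewrite -addrA; apply: le_trans (lerD hle (lexx (ln 2 + 1))).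
have cv : (fun n => ln (cover_number R (join_cover f (range (kernel_hull K)) n)) /
    n%:R + (ln 2 + 1)) @ \oo --> htop_cover R f (range (kernel_hull K)) + (ln 2 + 1).
  by apply: cvgD => //; exact: cvg_cst.
apply: (ler_cvg_to (partition_entropy_cvg mf xiP finv) cv).
apply: nearW => n /=; have := join_entropy_le_cover Xc cf finv xiP Kcl Kxi n.
have [->|n0] := posnP n.
  by rewrite !invr0 !mulr0 add0r addr_ge0// ln_ge0// ler1n.
have nR0 : 0 < n%:R :> R by rewrite ltr0n.
move=> le; rewrite ler_pdivrMr// mulrDl divfK ?gt_eqF//.
apply: (le_trans le); rewrite lerD2l mulrC ler_wpM2r ?(ltW nR0)//.
by rewrite lerD2l.
Qed.

(** * Borel measures from finitely additive means *)

Section finitely_additive.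
Context (R : realType) (X : pmetricType R).
Hypothesis Xcompact : compact [set: X].
Variable m : set X -> R.
Hypothesis m_ge0 : forall A, 0 <= m A.
Hypothesis m_setT : m setT = 1.
Hypothesis mU : forall A B, A `&` B = set0 -> m (A `|` B) = m A + m B.

Lemma fa_mono A B : A `<=` B -> m A <= m B.
Proof.
move=> AB; have -> : B = A `|` (B `\` A).
  by rewrite setDUK.
by rewrite mU ?setDIK// lerDl.
Qed.

Lemma fa_set0 : m set0 = 0.
Proof. by have := @mU set0 set0 (setI0 _); rewrite setU0; lra. Qed.

Lemma fa_bigcup (A : nat -> set X) n :
  m (\bigcup_(i < n) A i) <= \sum_(0 <= i < n) m (A i).
Proof.
elim: n => [|n IH]; first by rewrite big_geq// bigcup_mkord big_ord0 fa_set0.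
rewrite big_nat_recr//= bigcup_mkord big_ord_recr/= -bigcup_mkord.
set B := \bigcup_(i < n) A i.
rewrite -(setDUK (@subsetUl _ B (A n))).
rewrite mU ?setDIK// lerD//; apply: fa_mono.
by rewrite setDUl setDv set0U; exact: subDsetl.
Qed.

(** The mean [m] itself need not be countably subadditive on open sets; its inner values are, by
    compactness of the closed sets. *)
Definition open_content (G : set X) : \bar R :=
  ereal_sup [set (m K)%:E | K in [set K | closed K /\ K `<=` G]].

Lemma open_content_sup K G : closed K -> K `<=` G -> ((m K)%:E <= open_content G)%E.
Proof. by move=> cK KG; apply: ereal_sup_ubound; exists K. Qed.

Lemma open_content_le G : (open_content G <= (m G)%:E)%E.
Proof.
by apply: ge_ereal_sup => _ [K [_ KG] <-]; rewrite lee_fin; exact: fa_mono.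
Qed.

Lemma open_content_ge0 G : (0 <= open_content G)%E.
Proof. by apply: le_trans (open_content_sup (@closed0 _) (@sub0set _ G)); rewrite fa_set0. Qed.

Lemma open_content_fin G : open_content G \is a fin_num.
Proof.
rewrite ge0_fin_numE ?open_content_ge0//.
by apply: le_lt_trans (open_content_le G) _; rewrite ltry.
Qed.

Lemma open_content_bigcup (G : nat -> set X) : (forall n, open (G n)) ->
  (open_content (\bigcup_n G n) <= \sum_(n <oo) open_content (G n))%E.
Proof.
move=> oG; apply: ge_ereal_sup => _ [K [cK KG] <-].
have cpK : compact K by exact: subclosed_compact cK Xcompact _.
have /compact_near_coveringP := cpK.
(* The same [k] bounds the number of sets and sets the depth of the erosions, so compactness yields
   a single [k] for all points of [K]. *)
pose P k x := exists2 i, (i < k)%N & erosion (G i) k x.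
move=> /(_ nat \oo P _)[].
  move=> x /KG[i _ Gx]; have [[A B] /= [Ax Boo] AB] := near_erosion (oG i) Gx.
  exists (A, B `&` [set k | (i < k)%N]) => /=.
    by split => //; apply: filterI => //; exists i.+1.
  by move=> [x' k] /= [Ax' [Bk ik]]; exists i => //; exact: (AB (x', k)).
move=> k _ /(_ k (leqnn k))/= KP.
apply: (@le_trans _ _ (\sum_(0 <= n < k) open_content (G n))%E); last first.
  by apply: nneseries_lim_ge => n _ _; exact: open_content_ge0.
apply: (@le_trans _ _ (\sum_(0 <= n < k) m (erosion (G n) k))%:E).
  rewrite lee_fin; apply: le_trans (fa_bigcup _ _); apply: fa_mono.
  by move=> x /KP[i ik ex]; exists i.
rewrite -sumEFin lee_sum// => n _.
by apply: open_content_sup; [exact: closed_erosion|exact: erosion_sub].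
Qed.

Definition outer_content (E : set X) : \bar R :=
  ereal_inf [set open_content G | G in [set G | open G /\ E `<=` G]].

Lemma outer_content_inf E G : open G -> E `<=` G -> (outer_content E <= open_content G)%E.
Proof. by move=> oG EG; apply: ereal_inf_lbound; exists G. Qed.

Lemma outer_content_open G : open G -> outer_content G = open_content G.
Proof.
move=> oG; apply/eqP; rewrite eq_le outer_content_inf//=.
apply: le_ereal_inf_tmp => _ [H [oH GH] <-]; apply: ereal_sup_le => _ [K [cK KG] <-].
by exists K => //; split => //; exact: subset_trans GH.
Qed.

Lemma outer_content_ge0 E : (0 <= outer_content E)%E.
Proof. by apply: le_ereal_inf_tmp => _ [G _ <-]; exact: open_content_ge0. Qed.

Lemma outer_content_fin E : outer_content E \is a fin_num.
Proof.
rewrite ge0_fin_numE ?outer_content_ge0//.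
apply: le_lt_trans (outer_content_inf openT (@subsetT _ E)) _.
by rewrite -ge0_fin_numE ?open_content_ge0// open_content_fin.
Qed.

Let outer_content0 : outer_content set0 = 0%E.
Proof.
apply/eqP; rewrite eq_le outer_content_ge0 andbT.
rewrite outer_content_open; last exact: open0.
by apply: le_trans (open_content_le _) _; rewrite fa_set0.
Qed.

Let outer_content_mono : {homo outer_content : A B / A `<=` B >-> (A <= B)%E}.
Proof.
move=> A B AB; apply: le_ereal_inf_tmp => _ [G [oG BG] <-].
by apply: outer_content_inf => //; exact: subset_trans BG.
Qed.

Let outer_content_sigma_subadditive : sigma_subadditive outer_content.
Proof.
move=> A; apply/lee_addgt0Pr => e e0.
have /choice[G GP] : forall n, exists G, [/\ open G, A n `<=` G &
    (open_content G <= outer_content (A n) + (e / (2 ^ n.+1)%:R)%:E)%E].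
  move=> n; have p : 0 < e / (2 ^ n.+1)%:R by rewrite divr_gt0// ltr0n expn_gt0.
  have [_ [G [oG AG] <-] /ltW le] := lb_ereal_inf_adherent p (outer_content_fin (A n)).
  by exists G.
apply: (@le_trans _ _ (open_content (\bigcup_n G n))).
  apply: outer_content_inf; first by apply: bigcup_open => n _; have [] := GP n.
  by apply: subset_bigcup => n _; have [] := GP n.
apply: (@le_trans _ _ (\sum_(n <oo) open_content (G n))%E).
  by apply: open_content_bigcup => n; have [] := GP n.
have := @epsilon_trick R (outer_content \o A) e xpredT
  (fun n => outer_content_ge0 (A n)) (ltW e0).
apply: le_trans.
apply: lee_nneseries => n _; first by rewrite open_content_ge0.
by have [] := GP n.
Qed.

HB.instance Definition _ := isOuterMeasure.Build R X outer_content
  outer_content0 outer_content_ge0 outer_content_mono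
  outer_content_sigma_subadditive.

(** Given an open [G] containing [E], choose a closed [K] inside both [G] and [U], then a closed [L]
    inside [G] and off [K]. Removing [K] from [G] leaves an open set containing the part of [E] off
    [U], and additivity of [m] on the disjoint [K] and [L] bounds the two parts together by the
    content of [G]. *)
Lemma open_caratheodory (U : set X) : open U -> outer_content.-caratheodory U.
Proof.
move=> oU; apply: le_caratheodory_measurable => E.
apply: le_ereal_inf_tmp => _ [G [oG EG] <-].
have fin A := outer_content_fin A.
rewrite -leeBrDr ?fin//.
apply: (@le_trans _ _ (open_content (G `&` U))).
  by apply: outer_content_inf; [exact: openI|exact: setSI].
apply: ge_ereal_sup => _ [K [cK KG] <-].
rewrite leeBrDr ?fin// addeC -leeBrDr//.
apply: (@le_trans _ _ (open_content (G `\` K))).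
  apply: outer_content_inf; first by rewrite setDE; apply: openI => //; exact: closed_openC.
  by move=> x [/EG Gx Ux]; split => // /KG[].
apply: ge_ereal_sup => _ [L [cL LG] <-].
rewrite leeBrDr// -EFinD addrC -mU; last first.
  by rewrite -subset0 => x [Kx /LG[_]].
apply: open_content_sup; first exact: closedU.
by move=> x [/KG[]|/LG[]].
Qed.

Definition content_measure : set (borel X) -> \bar R := outer_content.

Let content_measure0 : content_measure set0 = 0%E.
Proof. exact: outer_content0. Qed.

Let content_measure_ge0 A : (0 <= content_measure A)%E.
Proof. exact: outer_content_ge0. Qed.

Let borel_caratheodory (A : set (borel X)) :
  measurable A -> outer_content.-caratheodory A.
Proof.
suff : <<s @open X >> `<=` outer_content.-caratheodory by apply.
apply: smallest_sub => [|U]; last exact: open_caratheodory.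
split=> [|B mB|B mB].
- exact: caratheodory_measurable_set0.
- by rewrite setTD; exact: caratheodory_measurable_setC.
- exact: caratheodory_measurable_bigcup.
Qed.

Let content_measure_sigma_additive : semi_sigma_additive content_measure.
Proof.
move=> F mF tF mUF.
apply: (@caratheodory_measure_sigma_additive R X outer_content) => //.
  by move=> i; exact: borel_caratheodory.
exact: borel_caratheodory.
Qed.

HB.instance Definition _ := isMeasure.Build _ _ _ content_measure
  content_measure0 content_measure_ge0 content_measure_sigma_additive.

Let content_measureT : content_measure setT = 1%E.
Proof.
rewrite /content_measure outer_content_open; last exact: openT.
apply/eqP; rewrite eq_le; apply/andP; split.
  by apply: le_trans (open_content_le _) _; rewrite m_setT.
have := open_content_sup (@closedT X) (@subsetT _ setT).
by rewrite m_setT.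
Qed.

HB.instance Definition _ := Measure_isProbability.Build _ _ _ content_measure
  content_measureT.

Lemma exists_content_measure :
  exists mu : probability (borel X) R, forall A, mu A = outer_content A.
Proof. by exists content_measure. Qed.

End finitely_additive.

(** * Means along orbits *)

Section empirical_mean.
Context (R : realType) (X : Type) (z : nat -> nat -> X) (N : nat -> nat).
Hypothesis N_gt0 : forall n, (0 < N n)%N.

(** Row [n] of [z] is an orbit, of which the first [N n] points count. The row index lets a flow be
    sampled with ever finer steps. *)
Definition visits n (A : set X) : nat := \sum_(0 <= i < N n) (z n i \in A).

Lemma visits_le n A : (visits n A <= N n)%N.
Proof.
rewrite -[leqRHS]subn0 -[leqRHS]muln1 -sum_nat_const_nat leq_sum// => i _.
exact: leq_b1.
Qed.

Lemma visitsU n A B : A `&` B = set0 -> visits n (A `|` B) = (visits n A + visits n B)%N.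
Proof.
move=> AB; rewrite -big_split/=; apply: eq_bigr => i _; rewrite in_setU.
case: (boolP (z n i \in A)) => //= /set_mem Az.
by rewrite memNset// => Bz; have : (A `&` B) (z n i) by []; rewrite AB.
Qed.

(** Applying [g] moves the window of times by [c]; the old and the new window each contain at most
    [c] times that the other misses. *)
Lemma visits_shift n (g : X -> X) (c : nat) (A : set X) :
  (forall i, g (z n i) = z n (i + c)%N) ->
  (visits n (g @^-1` A) <= visits n A + c)%N /\
  (visits n A <= visits n (g @^-1` A) + c)%N.
Proof.
move=> gz; pose b i : nat := z n i \in A.
have b1 p q : (\sum_(p <= i < q) b i <= q - p)%N.
  by rewrite -[leqRHS]muln1 -sum_nat_const_nat leq_sum// => i _; exact: leq_b1.
have gE : visits n (g @^-1` A) = (\sum_(c <= i < N n + c) b i)%N.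
  rewrite -{1}[c]add0n big_addn addnK; apply: eq_bigr => i _.
  by rewrite /b -gz; congr nat_of_bool; apply/idP/idP => /set_mem ?; exact/mem_set.
have E : (\sum_(0 <= i < c) b i + \sum_(c <= i < N n + c) b i =
    \sum_(0 <= i < N n) b i + \sum_(N n <= i < N n + c) b i)%N.
  by rewrite -!big_cat_nat ?leq_addr ?leq_addl.
have := b1 0%N c; have := b1 (N n) (N n + c)%N.
by rewrite gE /visits; rewrite /b in E *; lia.
Qed.

(** Along an ultrafilter the visit frequencies of every subset converge, so their limit is additive.
    The last clause is the link to the dynamics: comparing visits up to a negligible number will
    give both invariance and full mass. *)
Lemma exists_mean : exists m : set X -> R, [/\ forall A, 0 <= m A, m setT = 1,
  (forall A B, A `&` B = set0 -> m (A `|` B) = m A + m B) &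
  forall (A B : set X) (c : nat -> nat),
    (forall e : R, 0 < e -> \forall n \near \oo, (c n)%:R <= e * (N n)%:R) ->
    (\forall n \near \oo, (visits n A <= visits n B + c n)%N) -> m A <= m B].
Proof.
pose fr A n : R := (visits n A)%:R / (N n)%:R.
have NR0 n : 0 < (N n)%:R :> R by rewrite ltr0n.
have fr0 A n : 0 <= fr A n by rewrite divr_ge0.
have fr1 A n : fr A n <= 1 by rewrite ler_pdivrMr// mul1r ler_nat visits_le.
have [G [GU sG]] := @ultraFilterLemma nat \oo _.
have GP : ProperFilter G by exact: ultra_proper.
(* For an ultrafilter the supremum of the eventual lower bounds is a limit: a slightly larger number
   is not an eventual lower bound, hence it eventually exceeds the frequency. *)
pose S A := [set r | G [set n | r <= fr A n]].
have S0 A : S A 0 by apply: filterS filterT => n _; exact: fr0.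
have Sub A : ubound (S A) 1.
  by move=> r /filter_ex[n /= rn]; exact: le_trans (fr1 A n).
have Ssup A : has_sup (S A) by split; [exists 0|exists 1].
pose m A := sup (S A).
have mcvg A : fr A @ G --> m A.
  apply/cvgrPdist_le => e e0.
  have [r Sr rm] := sup_adherent e0 (Ssup A).
  have [|Ge] := in_ultra_setVsetC [set n | m A + e <= fr A n] GU.
    move=> /(ub_le_sup (Ssup A).2); rewrite -/(m A) -subr_ge0 opprD addNKr oppr_ge0.
    by rewrite leNgt e0.
  apply: filterS (filterI Sr Ge) => n [/= rn /negP]; rewrite -ltNge => me.
  by rewrite ler_distlC; apply/andP; split; [apply: le_trans rn; apply: ltW|exact: ltW].
exists m; split.
- by move=> A; apply: ub_le_sup; [exact: (Ssup A).2|exact: S0].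
- apply/eqP; rewrite eq_le; apply/andP; split.
    by apply: sup_le_ub; [exists 0|exact: Sub].
  apply: ub_le_sup; first exact: (Ssup setT).2.
  apply: filterS filterT => n _ /=.
  rewrite ler_pdivlMr// mul1r ler_nat /visits (eq_bigr (fun=> 1%N)).
    by rewrite sum_nat_const_nat muln1 subn0.
  by move=> i _; rewrite in_setT.
- move=> A B AB; apply: (cvg_unique (@Rhausdorff R) (mcvg _)).
  rewrite (_ : fr (A `|` B) = fr A \+ fr B).
    by apply: cvgD; exact: mcvg.
  by apply/funext => n; rewrite /= /fr visitsU// natrD mulrDl.
- move=> A B c ce AB; apply/ler_addgt0Pr => e e0.
  have cv : fr B n + e @[n --> G] --> m B + e.
    by apply: cvgD; [exact: mcvg|exact: cvg_cst].
  apply: (ler_cvg_to (mcvg A) cv); apply: sG; near=> n.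
  rewrite /fr ler_pdivrMr// mulrDl divfK ?gt_eqF//.
  apply: (@le_trans _ _ ((visits n B + c n)%N)%:R).
    by rewrite ler_nat; near: n.
  by rewrite natrD lerD2l; near: n; exact: ce.
Unshelve. all: by end_near.
Qed.

End empirical_mean.

(** * From invariance of the mean to invariance of the measure *)

Section outer_content_preimage.
Context (R : realType) (X : pmetricType R) (m : set X -> R).

(** The hypothesis compares closed sets with open ones instead of asking that [m] be invariant under
    [g]: for a flow, [m] will be known to be invariant under dyadic times only. *)
Lemma outer_content_preimage_le (g : X -> X) (E : set X) : continuous g ->
  (forall K G, closed K -> open G -> K `<=` g @^-1` G ->
    ((m K)%:E <= open_content m G)%E) ->
  (outer_content m (g @^-1` E) <= outer_content m E)%E.
Proof.
move=> cg H; apply: le_ereal_inf_tmp => _ [G [oG EG] <-].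
have ogG : open (g @^-1` G) by apply: open_comp => // x _; exact: cg.
apply: (le_trans (outer_content_inf _ ogG _)); first by move=> x /EG.
by apply: ge_ereal_sup => _ [K [cK KG] <-]; exact: H.
Qed.

Lemma outer_content_preimage (g h : X -> X) (E : set X) :
  continuous g -> continuous h -> cancel g h -> cancel h g ->
  (forall K G, closed K -> open G -> K `<=` g @^-1` G ->
    ((m K)%:E <= open_content m G)%E) ->
  (forall K G, closed K -> open G -> K `<=` h @^-1` G ->
    ((m K)%:E <= open_content m G)%E) ->
  outer_content m (g @^-1` E) = outer_content m E.
Proof.
move=> cg ch gh hg Hg Hh; apply/eqP; rewrite eq_le outer_content_preimage_le//=.
have {1}-> : E = h @^-1` (g @^-1` E).
  by apply/seteqP; split => x /=; rewrite hg.
exact: outer_content_preimage_le.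
Qed.

(* [K] is moved into [G]: its image [g @` K = h @^-1` K] is closed and has the same mean. *)
Lemma mean_le_open_content (g h : X -> X) (K G : set X) :
  continuous h -> cancel g h -> cancel h g -> (forall A, m (h @^-1` A) = m A) ->
  closed K -> K `<=` g @^-1` G -> ((m K)%:E <= open_content m G)%E.
Proof.
move=> ch gh hg mh cK KG; rewrite -mh; apply: ereal_sup_ubound.
exists (h @^-1` K) => //; split; first by apply: closed_comp => // x _; exact: ch.
by move=> x /KG /=; rewrite hg.
Qed.

End outer_content_preimage.

(** * Existence of invariant measures *)

Definition sublinear_to (R : realType) (c N : nat -> nat) :=
  forall e : R, 0 < e -> \forall n \near \oo, (c n)%:R <= e * (N n)%:R.

Lemma visits_tail (X : Type) (z : nat -> nat -> X) (N : nat -> nat) n c (A : set X) :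
  (forall i, (c <= i)%N -> A (z n i)) -> (N n <= visits z N n A + c)%N.
Proof.
move=> cA.
have [Nc|/ltnW cN] := leqP (N n) c; first exact: leq_trans Nc (leq_addl _ _).
rewrite /visits (big_cat_nat (n := c))//=.
rewrite [X in (_ + X + _)%N](eq_big_nat _ _ (F2 := fun=> 1%N)).
  by rewrite sum_nat_const_nat muln1; lia.
by move=> i /andP[ci _]; rewrite mem_set//; exact: cA.
Qed.

(** Common source of the measures for maps and for flows; [c n] is the shift caused by [g] or the
    number of initial points discarded. Full mass of [G] asks for a closed [K] below it because
    [mu G] is a supremum over closed subsets; mass 0 follows directly, since [mu G] is at most
    [m G]. The mean is returned as well because the invariance of [mu] is derived from it
    differently in the two cases. *)
Lemma exists_orbit_measure (R : realType) (X : pmetricType R)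
    (z : nat -> nat -> X) (N : nat -> nat) :
  compact [set: X] -> (forall n, (0 < N n)%N) ->
  exists (m : set X -> R) (mu : probability (borel X) R),
  [/\ forall A, mu A = outer_content m A,
    forall (g : X -> X) (c : nat -> nat), sublinear_to R c N ->
      (\forall n \near \oo, forall i, g (z n i) = z n (i + c n)%N) ->
      forall A, m (g @^-1` A) = m A,
    forall (c : nat -> nat) (K G : set X), sublinear_to R c N ->
      (forall n i, (c n <= i)%N -> K (z n i)) ->
      closed K -> open G -> K `<=` G -> mu G = 1%E &
    forall (c : nat -> nat) (G : set X), sublinear_to R c N ->
      (forall n i, (c n <= i)%N -> ~ G (z n i)) -> open G -> mu G = 0%E].
Proof.
move=> Xc N0; have [m [m0 m1 mU mle]] := exists_mean R z N0.
have [mu muE] := exists_content_measure Xc m0 m1 mU.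
have tail c K : sublinear_to R c N ->
    (forall n i, (c n <= i)%N -> K (z n i)) -> m K = 1.
  move=> cN cK; apply/eqP; rewrite eq_le -{1}m1 fa_mono//= -m1; apply: (mle _ _ c) => //.
  by apply: nearW => n; exact: leq_trans (visits_le _ _ _ _) (visits_tail _ (cK n)).
exists m, mu; split => //.
- move=> g c cN gz A; apply/eqP; rewrite eq_le; apply/andP; split;
    by apply: (mle _ _ c) => //; apply: filterS gz => n /(visits_shift N A)[].
- move=> c K G cN cK clK oG KG; rewrite muE outer_content_open//.
  apply/eqP; rewrite eq_le; apply/andP; split.
    by apply: le_trans (open_content_le m0 mU G) _; rewrite -m1 lee_fin fa_mono.
  by have := open_content_sup m clK KG; rewrite (tail c).
- move=> c G cN cG oG; rewrite muE outer_content_open//.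
  apply/eqP; rewrite eq_le open_content_ge0// andbT.
  apply: le_trans (open_content_le m0 mU G) _; rewrite lee_fin.
  have := mU G (~` G) (setICr G); rewrite setUCr m1 (tail c (~` G))//.
  by move/eqP; rewrite -subr_eq subrr => /eqP <-.
Qed.

(** The conditions start at the first iterate: the starting point used later lies in the absorbing
    set, but only its iterates are known to lie in the image of that set. *)
Lemma homeo_invariant_measure (R : realType) (X : pmetricType R)
    (f g : X -> X) (x : X) : compact [set: X] ->
  continuous f -> continuous g -> cancel f g -> cancel g f ->
  exists mu : probability (borel X) R, [/\ invariant_measure mu f,
    forall K G : set X, (forall n, K (iter n.+1 f x)) ->
      closed K -> open G -> K `<=` G -> mu G = 1%E &
    forall G : set X, (forall n, ~ G (iter n.+1 f x)) -> open G -> mu G = 0%E].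
Proof.
move=> Xc cf cg fg gf.
have [m [mu [muE minv mu1 mu0]]] :=
  @exists_orbit_measure R X (fun _ i => iter i f x) S Xc (fun=> isT).
have c1 : sublinear_to R (fun=> 1%N) S.
  move=> e e0; near=> n; rewrite -ler_pdivrMl// mulr1.
  apply: (@le_trans _ _ n%:R); last by rewrite ler_nat.
  by near: n; exact: nbhs_infty_ger.
exists mu; split.
- have mf A : m (f @^-1` A) = m A.
    apply: (minv f (fun=> 1%N)) => //.
    by apply: nearW => n i; rewrite addn1.
  have mg A : m (g @^-1` A) = m A.
    by rewrite -mf; congr m; apply/seteqP; split => y /=; rewrite fg.
  move=> A _; rewrite !muE; apply: (@outer_content_preimage R X m f g A cf cg fg gf) => K G cK _.
    exact: (mean_le_open_content cg fg gf).
  exact: (mean_le_open_content cf gf fg).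
- by move=> K G Kx; apply: (mu1 (fun=> 1%N)) => // _ [//|i] _; exact: Kx.
- by move=> G Gx; apply: (mu0 (fun=> 1%N)) => // _ [//|i] _; exact: Gx.
Unshelve. all: by end_near.
Qed.

(** Rounding [t * 2 ^ k] down; it replaces a real time by a dyadic one in an open condition. *)
Lemma dyadic_near (R : realType) (t : R) (A : set R) : 0 <= t -> nbhs t A ->
  exists j k : nat, A (j%:R / (2 ^ k)%:R).
Proof.
move=> t0 /nbhs_ballP[e /= e0 eA].
pose k := Num.bound e^-1.
have k2 : 0 < (2 ^ k)%:R :> R by rewrite ltr0n expn_gt0.
have ke : (2 ^ k)%:R^-1 < e.
  rewrite -[e]invrK ltf_pV2 ?posrE ?invr_gt0//.
  apply: (@lt_trans _ _ k%:R); first by rewrite archi_boundP// invr_ge0 ltW.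
  by rewrite ltr_nat ltn_expl.
exists (Num.truncn (t * (2 ^ k)%:R)), k; apply: eA.
have /truncn_itv/andP[lo hi] : 0 <= t * (2 ^ k)%:R by rewrite mulr_ge0// ltW.
rewrite /ball/= ger0_norm; last by rewrite subr_ge0 ler_pdivrMr.
rewrite (le_lt_trans _ ke)// lerBlDr -[X in _ <= X + _]mul1r -mulrDl ler_pdivlMr//.
by rewrite addrC natr1 ltW.
Qed.

Section flow_time_maps.
Context (R : realType) (X : pmetricType R) (psi : R -> X -> X).
Hypothesis psiflow : continuous_flow psi.

Lemma continuous_flow_time t : continuous (psi t).
Proof.
have [cpsi _ _] := psiflow; move=> y.
apply: (@continuous_comp _ _ _ (fun y => (t, y)) (fun p => psi p.1 p.2)).
  move=> P [[A B] /= [At By] AB]; apply: filterS By => y' By'.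
  by apply: (AB (t, y')); split => //=; exact: nbhs_singleton.
exact: cpsi.
Qed.

Lemma flowK t : cancel (psi t) (psi (- t)).
Proof. by have [_ psi0 psiD] := psiflow; move=> y; rewrite -psiD subrr psi0. Qed.

Lemma flowNK t : cancel (psi (- t)) (psi t).
Proof. by have [_ psi0 psiD] := psiflow; move=> y; rewrite -psiD addNr psi0. Qed.

End flow_time_maps.

(** Row [n] samples the orbit with step [1 / 2 ^ n] over a duration [n.+1], which makes the mean
    invariant under dyadic times. For a real time [t], the inclusion of a closed, hence compact, [K]
    in the preimage of an open [G] persists for nearby times, some of them dyadic, and this suffices
    to compare [K] with [G]. *)
Lemma flow_invariant_measure (R : realType) (X : pmetricType R)
    (psi : R -> X -> X) (x : X) : compact [set: X] -> continuous_flow psi ->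
  exists mu : probability (borel X) R, [/\ forall t, invariant_measure mu (psi t),
    forall (K G : set X) T, (forall t, T <= t -> K (psi t x)) ->
      closed K -> open G -> K `<=` G -> mu G = 1%E &
    forall (G : set X) T, (forall t, T <= t -> ~ G (psi t x)) -> open G -> mu G = 0%E].
Proof.
move=> Xc psiflow; have [cpsi psi0 psiD] := psiflow.
have cpsit t : continuous (psi t) by exact: continuous_flow_time.
have psiK := flowK psiflow; have psiNK := flowNK psiflow.
pose N n := (n.+1 * 2 ^ n)%N.
have p2 n : 0 < (2 ^ n)%:R :> R by rewrite ltr0n expn_gt0.
have sub j : sublinear_to R (fun n => (j * 2 ^ n)%N) N.
  move=> e e0; near=> n; rewrite !natrM mulrA ler_wpM2r ?(ltW (p2 n))//.
  rewrite -ler_pdivrMl//; apply: (@le_trans _ _ n%:R); last by rewrite ler_nat.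
  by near: n; exact: nbhs_infty_ger.
have [|m [mu [muE minv mu1 mu0]]] :=
  @exists_orbit_measure R X (fun n i => psi (i%:R / (2 ^ n)%:R) x) N Xc.
  by move=> n; rewrite muln_gt0 expn_gt0.
have mpos j k A : m (psi (j%:R / (2 ^ k)%:R) @^-1` A) = m A.
  (* Once [n >= k], the time [j / 2 ^ k] is a whole number of sampling steps. *)
  apply: (minv _ (fun n => (j * 2 ^ (n - k))%N)) => [e e0|].
    apply: filterS (sub j e e0) => n; apply: le_trans.
    by rewrite ler_nat leq_mul2l leq_exp2l// leq_subr orbT.
  near=> n => i; rewrite -psiD; congr (psi _ x).
  have kn : (k <= n)%N by near: n; exists k.
  rewrite natrD mulrDl natrM; congr (_ + _).
  have -> : (2 ^ n)%:R = (2 ^ (n - k))%:R * (2 ^ k)%:R :> R.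
    by rewrite -natrM -expnD subnK.
  by rewrite invfM mulrA mulfK// gt_eqF.
have mneg j k A : m (psi (- (j%:R / (2 ^ k)%:R)) @^-1` A) = m A.
  by rewrite -(mpos j k); congr m; apply/seteqP; split => y /=; rewrite psiK.
have near_sub K G t : closed K -> open G -> K `<=` psi t @^-1` G ->
    \forall s \near t, K `<=` psi s @^-1` G.
  move=> cK oG KG; have /compact_near_coveringP : compact K.
    exact: subclosed_compact cK Xc _.
  move=> /(_ R (nbhs t) (fun s => psi s @^-1` G) _); apply => y Ky.
  have [[A B] /= [At By] AB] : nbhs (t, y) [set p | G (psi p.1 p.2)].
    by apply: cpsi; apply: open_nbhs_nbhs; split => //; exact: KG.
  by exists (B, A) => //= -[y' s] /= [By' As]; exact: (AB (s, y')).
have le_oc t K G : closed K -> open G -> K `<=` psi t @^-1` G ->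
    ((m K)%:E <= open_content m G)%E.
  move=> cK oG KG; have nt := near_sub K G t cK oG KG.
  have [t0|/ltW t0] := leP 0 t.
    have [j [k KGs]] := dyadic_near t0 nt.
    exact: (mean_le_open_content (@cpsit _) (psiK _) (psiNK _) (mneg j k) cK KGs).
  have nt' : nbhs (- t) [set s | K `<=` psi (- s) @^-1` G].
    have : - s @[s --> - t] --> t by rewrite -[X in _ --> X]opprK; exact: cvgN.
    by move=> /(_ _ nt).
  rewrite -oppr_ge0 in t0; have [j [k KGs]] := dyadic_near t0 nt'.
  exact: (mean_le_open_content (@cpsit _) (psiNK _) (psiK _) (mpos j k) cK KGs).
have time_le (T : R) n i : (Num.bound `|T| * 2 ^ n <= i)%N -> T <= i%:R / (2 ^ n)%:R.
  move=> ni; rewrite ler_pdivlMr//.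
  apply: (@le_trans _ _ ((Num.bound `|T|)%:R * (2 ^ n)%:R)).
    by rewrite ler_wpM2r ?(ltW (p2 n))//; apply: ltW; rewrite (le_lt_trans (ler_norm T))// archi_boundP.
  by rewrite -natrM ler_nat.
exists mu; split.
- move=> t A _; rewrite !muE.
  apply: (@outer_content_preimage R X m _ _ A (@cpsit t) (@cpsit (- t)) (psiK t) (psiNK t)).
    by move=> K G; exact: le_oc.
  by move=> K G; exact: le_oc.
- move=> K G T Kx; apply: (mu1 (fun n => (Num.bound `|T| * 2 ^ n)%N)) => // n i ni.
  by apply: Kx; exact: time_le ni.
- move=> G T Gx; apply: (mu0 (fun n => (Num.bound `|T| * 2 ^ n)%N)) => // n i ni.
  by apply: Gx; exact: time_le ni.
Unshelve. all: by end_near.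
Qed.

(** * Conditioning and pressure *)

Lemma cvg_combination (R : realType) (u v : nat -> R) (a b c l1 l2 : R) :
  u @ \oo --> l1 -> v @ \oo --> l2 ->
  (fun n => a * u n + b * v n + c * n%:R^-1) @ \oo --> a * l1 + b * l2.
Proof.
move=> ul vl; rewrite -[X in _ --> X]addr0 -(mulr0 c).
have inv0 : (fun n => n%:R^-1 : R) @ \oo --> (0 : R).
  by rewrite -cvg_shiftS; exact: cvg_harmonic.
exact: cvgD (cvgD (cvgM (cvg_cst a) ul) (cvgM (cvg_cst b) vl)) (cvgM (cvg_cst c) inv0).
Qed.

Section conditioning.
Context (R : realType) d (T : measurableType d) (mu : probability T R).

(** [mnormalize] falls back on [mu] when [V] is null, so this is a probability for every [V]; the
    estimates below concern [V] of nonzero mass. *)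
Definition conditional (V : set T) (mV : measurable V) : probability T R :=
  mnormalize (mrestr mu mV) mu.

Lemma conditionalE (V : set T) (mV : measurable V) A : mu V != 0%E ->
  conditional mV A = (mu (A `&` V) * (fine (mu V))^-1%:E)%E.
Proof.
move=> V0; pose e := mu ([set: T] `&` V).
rewrite -[LHS]/((if (e == 0) || (e == +oo) then fun U : set T => mu U
  else fun U => mu (U `&` V) * (fine e)^-1%:E) A)%E.
rewrite /e setTI (negbTE V0)/=.
by rewrite lt_eqF// ltey_eq fin_num_measure.
Qed.

Lemma fine_conditional (V : set T) (mV : measurable V) A : mu V != 0%E ->
  measurable A -> fine (mu V) * fine (conditional mV A) = fine (mu (A `&` V)).
Proof.
move=> V0 mA; have fV : fine (mu V) != 0 by rewrite fine_eq0// fin_num_measure.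
have mAV : measurable (A `&` V) by exact: measurableI.
rewrite conditionalE// -(@fineK _ (mu (A `&` V)) (fin_num_measure mu _ mAV)) -EFinM /=.
by rewrite mulrCA mulfV// mulr1.
Qed.

Lemma null_inclusion (N A B : set T) : measurable N -> measurable A ->
  measurable B -> mu N = 0%E -> (forall x, ~ N x -> A x -> B x) ->
  (mu A <= mu B)%E.
Proof.
move=> mN mA mB N0 AB; apply: (@le_trans _ _ (mu (B `|` N))).
  apply: le_measure; rewrite ?inE//; first exact: measurableU.
  by move=> x Ax; have [Nx|Nx] := pselect (N x); [right|left; exact: AB].
apply: (@le_trans _ _ (mu B + mu N)%E); first exact: measureU2.
by rewrite N0 adde0.
Qed.

(** Off [N] a point lies in [V] exactly when its image does, so the two sets whose masses are
    compared agree up to a null set. This is the kind of invariance that an absorbing set has. *)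
Lemma conditional_invariant (V N : set T) (mV : measurable V) (f : T -> T) :
  measurable_fun setT f -> invariant_measure mu f -> mu V != 0%E ->
  measurable N -> mu N = 0%E -> (forall x, ~ N x -> V x <-> V (f x)) ->
  invariant_measure (conditional mV) f.
Proof.
move=> mf finv V0 mN N0 VN A mA; rewrite !conditionalE//; congr (_ * _)%E.
have pre B : measurable B -> measurable (f @^-1` B).
  by move=> mB; rewrite -[_ @^-1` _]setTI; exact: mf.
have mAV : measurable (A `&` V) by exact: measurableI.
rewrite -[RHS]finv//; apply/eqP; rewrite eq_le.
have mL : measurable (f @^-1` A `&` V) by apply: measurableI => //; exact: pre.
have mR : measurable (f @^-1` (A `&` V)) by exact: pre.
by apply/andP; split; apply: (null_inclusion mN) => // x /VN Vx [? ?]; split => //; exact/Vx.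
Qed.

Variables (V : set T) (mV : measurable V).
Hypotheses (V0 : mu V != 0%E) (VC0 : mu (~` V) != 0%E).
Let mVC : measurable (~` V) := measurableC mV.
Let p := fine (mu (~` V)).

Lemma fine_measureC : fine (mu V) = 1 - p.
Proof.
have -> : mu V = (1 - mu (~` V))%E by rewrite -probability_setC// setCK.
by rewrite fineB// fin_num_measure.
Qed.

Variables (f : T -> T) (mf : measurable_fun setT f).
Variables (k : nat) (xi : 'I_k -> set T) (xiP : measurable_partition xi).

(** One half of the affinity of entropy. A block has mass [a + b], one share from each side of [V],
    and monotonicity of [ln] makes the entropy term of [a + b] at most the sum of those of [a] and
    [b]. The price is the last term, the entropy of the partition into [V] and its complement; it
    does not depend on [n] and disappears after division by [n]. *)
Lemma join_entropy_conditional n :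
  join_entropy mu f xi n <=
  (1 - p) * join_entropy (conditional mV) f xi n +
  p * join_entropy (conditional mVC) f xi n - ((1 - p) * ln (1 - p) + p * ln p).
Proof.
have finV A : measurable A -> mu A \is a fin_num by exact: fin_num_measure.
have p0 : 0 < p by rewrite fine_gt0// lt0e VC0 measure_ge0/= ltey_eq finV.
have q0 : 0 < 1 - p.
  by rewrite -fine_measureC fine_gt0// lt0e V0 measure_ge0/= ltey_eq finV.
have split_mass (w : {ffun 'I_n -> 'I_k}) : cyl_mass mu f xi w =
    (1 - p) * cyl_mass (conditional mV) f xi w + p * cyl_mass (conditional mVC) f xi w.
  have mw := measurable_cylinder mf xiP w.
  rewrite -fine_measureC !fine_conditional// -fineD ?finV//; try exact: measurableI.
  congr fine; rewrite -measureU; [|exact: measurableI|exact: measurableI|].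
    by rewrite -setIUr setUCr setIT.
  by rewrite setIACA setICr setI0.
have mono (a b : R) : 0 <= a -> 0 <= b -> - ((a + b) * ln (a + b)) <= - (a * ln a) - b * ln b.
  move=> a0 b0; rewrite mulrDl opprD lerD// lerN2.
    have := a0; rewrite le_eqVlt => /predU1P[<-|ap]; first by rewrite !mul0r.
    by rewrite ler_wpM2l// ler_ln ?posrE ?lerDl// ltr_wpDr.
  have := b0; rewrite le_eqVlt => /predU1P[<-|bp]; first by rewrite !mul0r.
  by rewrite ler_wpM2l// ler_ln ?posrE ?lerDr// ltr_wpDl.
have xlnx (s q : R) : 0 < s -> 0 <= q ->
    - (s * q * ln (s * q)) = s * - (q * ln q) - q * (s * ln s).
  move=> s0; rewrite le_eqVlt => /predU1P[<-|qp].
    by rewrite mulr0 !mul0r oppr0 mulr0 addr0.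
  by rewrite lnM ?posrE//; ring.
rewrite !join_entropyE.
apply: (@le_trans _ _ (\sum_(w : {ffun 'I_n -> 'I_k})
   (((1 - p) * - (cyl_mass (conditional mV) f xi w * ln (cyl_mass (conditional mV) f xi w))
     - cyl_mass (conditional mV) f xi w * ((1 - p) * ln (1 - p))) +
    (p * - (cyl_mass (conditional mVC) f xi w * ln (cyl_mass (conditional mVC) f xi w))
     - cyl_mass (conditional mVC) f xi w * (p * ln p))))).
  apply: ler_sum => w _; rewrite split_mass -!xlnx ?cyl_mass_ge0//.
  by apply: mono; rewrite mulr_ge0 ?cyl_mass_ge0 ?ltW.
rewrite !big_split/= !sumrN -!mulr_suml !(sum_cyl_mass _ mf xiP) -!mulr_sumr !sumrN.
lra.
Qed.

Lemma partition_entropy_conditional :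
  invariant_measure mu f -> invariant_measure (conditional mV) f ->
  invariant_measure (conditional mVC) f ->
  partition_entropy mu f xi <= (1 - p) * partition_entropy (conditional mV) f xi +
    p * partition_entropy (conditional mVC) f xi.
Proof.
move=> i0 i1 i2; have c0 := partition_entropy_cvg mf xiP i0.
have c1 := partition_entropy_cvg mf xiP i1.
have c2 := partition_entropy_cvg mf xiP i2.
set c := (1 - p) * ln (1 - p) + p * ln p.
have c3 := @cvg_combination _ _ _ (1 - p) p (- c) _ _ c1 c2.
apply: (ler_cvg_to c0 c3); apply: nearW => n /=.
rewrite !mulrA -!mulrDl ler_wpM2r ?invr_ge0//.
exact: join_entropy_conditional.
Qed.

End conditioning.

Lemma metric_entropy_ge0 (R : realType) d (T : measurableType d)
    (mu : probability T R) (f : T -> T) : measurable_fun setT f ->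
  invariant_measure mu f -> (0 <= metric_entropy mu f)%E.
Proof.
move=> mf finv; pose xi (_ : 'I_1) : set T := setT.
have xiP : measurable_partition xi.
  split; last by move=> i; exact: measurableT.
  split.
  - by apply/seteqP; split => // x _; exists ord0.
  - by apply/trivIsetP => i j _ _; rewrite (ord1 i) (ord1 j) eqxx.
  - by move=> i _; exists point.
apply: (@le_trans _ _ (partition_entropy mu f xi)%:E).
  by rewrite lee_fin; exact: partition_entropy_ge0.
by apply: ereal_sup_ubound; exists 1%N, xi.
Qed.

(** The class [M] stands for the measures invariant under a map or under a whole flow. In the second
    case [f] is the time-one map while conditional measures must stay invariant under all times,
    hence the closure conditions on [M]. *)
Lemma pressure_not_analytic (R : realType) d (T : measurableType d) (f : T -> T)
    (M : set (probability T R)) (V : set T) (phi : T -> R) (C : R) :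
  measurable_fun setT f ->
  (forall mu, M mu -> invariant_measure mu f) ->
  (forall mu, M mu -> (metric_entropy mu f <= C%:E)%E) ->
  forall mV : measurable V,
  (forall mu, M mu -> mu V != 0%E -> M (conditional mu mV)) ->
  (forall mu, M mu -> mu (~` V) != 0%E -> M (conditional mu (measurableC mV))) ->
  (forall mu t, M mu ->
    (\int[mu]_x (t * phi x)%:E = (t * fine (mu (~` V)))%:E)%E) ->
  (exists2 mu, M mu & mu (~` V) = 0%E) -> (exists2 mu, M mu & mu (~` V) = 1%E) ->
  ~ real_analytic (fun t => fine (ereal_sup
      [set (metric_entropy mu f + \int[mu]_x (t * phi x)%:E)%E | mu in M])).
Proof.
move=> mf Minv MC mV MV MVC intphi [mu0 M0 mu0V] [mu1 M1 mu1V].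
have mVC := measurableC mV.
pose P t := ereal_sup
  [set (metric_entropy mu f + \int[mu]_x (t * phi x)%:E)%E | mu in M].
have h0 mu : M mu -> (0 <= metric_entropy mu f)%E.
  by move=> /Minv; exact: metric_entropy_ge0.
(* The measure [mu0] keeps this supremum from being [-oo]. *)
pose A := ereal_sup [set metric_entropy mu f | mu in [set mu | M mu /\ mu (~` V) = 0%E]].
have A0 : (0 <= A)%E.
  by apply: le_trans (h0 _ M0) _; apply: ereal_sup_ubound; exists mu0.
have AC : (A <= C%:E)%E by apply: ge_ereal_sup => _ [mu [/MC ? _] <-].
have [a [AE a0 aC]] : exists a, [/\ A = a%:E, 0 <= a & a <= C].
  by move: A0 AC; case: (A) => // a; rewrite !lee_fin => ? ?; exists a.
have hA mu : M mu -> mu (~` V) = 0%E -> (metric_entropy mu f <= a%:E)%E.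
  by move=> Mmu muV; rewrite -AE; apply: ereal_sup_ubound; exists mu.
have p01 (mu : probability T R) : 0 <= fine (mu (~` V)) <= 1.
  rewrite fine_ge0//= -lee_fin fineK; first exact: probability_le1.
  exact: fin_num_measure.
have hle mu : M mu -> (metric_entropy mu f <=
    ((1 - fine (mu (~` V))) * a + fine (mu (~` V)) * C)%:E)%E.
  move=> Mmu; have [muVC|muVC] := eqVneq (mu (~` V)) 0%E.
    by rewrite muVC /= subr0 mul1r mul0r addr0; exact: hA.
  have [muV|muV] := eqVneq (mu V) 0%E.
    have := fine_measureC mu mV; rewrite muV/= => /esym/eqP.
    by rewrite subr_eq0 => /eqP <-; rewrite subrr mul0r mul1r add0r; exact: MC.
  have M1' := MV _ Mmu muV; have M2' := MVC _ Mmu muVC.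
  apply: ge_ereal_sup => _ [k [xi [xiP ->]]]; rewrite lee_fin.
  have := partition_entropy_conditional muV muVC mf xiP (Minv _ Mmu) (Minv _ M1') (Minv _ M2').
  move/le_trans; apply; have /andP[p0 p1] := p01 mu.
  apply: lerD; apply: ler_wpM2l; rewrite ?subr_ge0// -lee_fin.
    apply: (@le_trans _ _ (metric_entropy (conditional mu mV) f)).
      by apply: ereal_sup_ubound; exists k, xi.
    by apply: hA => //; rewrite conditionalE// setICl measure0 mul0e.
  apply: (@le_trans _ _ (metric_entropy (conditional mu (measurableC mV)) f)).
    by apply: ereal_sup_ubound; exists k, xi.
  exact: MC.
(* With [p] the mass off [V], the upper bound is [(1 - p) * a + p * (C + t)], whose second term is
   not positive; measures carried by [V] give the converse. *)
have Pa t : t <= - C -> P t = a%:E.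
  move=> tC; apply/eqP; rewrite eq_le; apply/andP; split.
    apply: ge_ereal_sup => _ [mu Mmu <-]; rewrite intphi//.
    apply: (le_trans (leeD2r _ (hle _ Mmu))); rewrite -EFinD lee_fin.
    have /andP[p0 p1] := p01 mu.
    have : fine (mu (~` V)) * (C + t) <= 0 by rewrite mulr_ge0_le0//; lra.
    have : 0 <= fine (mu (~` V)) * a by rewrite mulr_ge0.
    by lra.
  rewrite -AE; apply: ge_ereal_sup => _ [mu [Mmu muV] <-].
  apply: ereal_sup_ubound; exists mu => //.
  by rewrite intphi// muV/= mulr0 adde0.
have FaC t : t <= - C -> fine (P t) = a by move=> /Pa ->.
move=> Fan; have := real_analytic_cst Fan FaC (C + 1); rewrite -/(P _).
have Plo : ((C + 1)%:E <= P (C + 1)%R)%E.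
  apply: (@le_trans _ _ (metric_entropy mu1 f + (C + 1)%:E)%E).
    by rewrite leeDr// h0.
  by apply: ereal_sup_ubound; exists mu1 => //; rewrite intphi// mu1V/= mulr1.
(* The upper bound excludes [+oo], which [fine] would send to 0. *)
have Phi : (P (C + 1)%R <= (C + (C + 1))%:E)%E.
  apply: ge_ereal_sup => _ [mu Mmu <-]; rewrite intphi// EFinD leeD ?MC//.
  by rewrite lee_fin; have /andP[p0 p1] := p01 mu; rewrite ler_piMr//; lra.
move: Plo Phi; case: (P _) => [r| |]//; rewrite !lee_fin /=.
by move=> Cr _ ra; move: Cr; rewrite ra => /le_trans/(_ aC); rewrite gerDl ler10.
Qed.

(** * Chains *)

Lemma continuous_borel_real (R : realType) (X : pmetricType R) (phi : X -> R) :
  continuous phi -> measurable_fun [set: borel X] (phi : borel X -> R).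
Proof.
move=> /continuousP cphi; apply: (measurability _ (RGenOpens.measurableE R)).
move=> _ [_ [a [b ->] <-]]; rewrite setTI; apply: open_borel.
exact/cphi/interval_open.
Qed.

Lemma lipschitz_continuous (R : realType) (X : metricType R) (phi : X -> R) (c : R) :
  0 < c -> (forall x y, `|phi x - phi y| <= c * mdist x y) -> continuous phi.
Proof.
move=> c0 lip x; apply/cvgrPdist_lt => e e0.
have d0 : 0 < c^-1 * e by rewrite mulr_gt0// invr_gt0.
apply: filterS (nbhsx_ballx x _ d0) => y; rewrite ballEmdist /= => xy.
by apply: le_lt_trans (lip x y) _; rewrite -ltr_pdivlMl.
Qed.

(** * The potential attached to an absorbing open set *)

Section bump.
Context (R : realType) (X : pmetricType R).
Variables (h : X -> X) (U : set X) (eps : R).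
Hypotheses (eps_gt0 : 0 < eps) (U0 : U !=set0).
Hypothesis absorbing : forall u z, U u -> mdist (h u) z < eps -> U z.

Definition image_dist (z : X) : R := inf [set mdist (h u) z | u in U].

(** The scale [eps] is the gap in [absorbing]: points outside [U] are at distance at least [eps]
    from the image of [U], where the truncation has reached 1. *)
Definition bump (z : X) : R := Num.min 1 (eps^-1 * image_dist z).

Lemma image_dist_lbound z : lbound [set mdist (h u) z | u in U] 0.
Proof. by move=> _ [u _ <-]; exact: mdist_ge0. Qed.

Lemma image_dist_nonempty z : [set mdist (h u) z | u in U] !=set0.
Proof. by have [u Uu] := U0; exists (mdist (h u) z), u. Qed.

Lemma image_dist_triangle z z' : image_dist z <= image_dist z' + mdist z z'.
Proof.
rewrite -lerBlDr; apply: lb_le_inf; first exact: image_dist_nonempty.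
move=> _ [u Uu <-]; rewrite lerBlDr.
apply: (@le_trans _ _ (mdist (h u) z)).
  by apply: ge_inf; [exists 0; exact: image_dist_lbound|exists u].
by rewrite (metric_sym z z'); exact: metric_triangle.
Qed.

Lemma bump_lipschitz z z' : `|bump z - bump z'| <= eps^-1 * mdist z z'.
Proof.
have e0 : 0 < eps^-1 by rewrite invr_gt0.
have le x y : eps^-1 * image_dist x <= eps^-1 * image_dist y + eps^-1 * mdist x y.
  by rewrite -mulrDr ler_pM2l// image_dist_triangle.
have d0 : 0 <= eps^-1 * mdist z z' by rewrite mulr_ge0 ?mdist_ge0// ltW.
have := le z z'; have := le z' z; rewrite (metric_sym z' z) /bump.
set a := eps^-1 * image_dist z; set b := eps^-1 * image_dist z'.
set c := eps^-1 * mdist z z' in d0 *.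
move=> ba ab; rewrite ler_norml /Num.min.
by case: (ltP 1 a) => ?; case: (ltP 1 b) => ?; apply/andP; split; lra.
Qed.

Lemma bump_image u : U u -> bump (h u) = 0.
Proof.
move=> Uu; suff -> : bump (h u) = Num.min 1 0 by rewrite min_r.
congr Num.min; rewrite (_ : image_dist _ = 0) ?mulr0//.
apply/eqP; rewrite eq_le; apply/andP; split.
  by apply: ge_inf; [exists 0; exact: image_dist_lbound|exists u => //; exact: mdistxx].
by apply: lb_le_inf; [exact: image_dist_nonempty|exact: image_dist_lbound].
Qed.

Lemma bump_setC z : ~ U z -> bump z = 1.
Proof.
move=> Uz; rewrite /bump min_l// ler_pdivlMl// mulr1.
apply: lb_le_inf; first exact: image_dist_nonempty.
by move=> _ [u Uu <-]; rewrite leNgt; apply/negP => /(absorbing Uu).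
Qed.

Lemma bump_hoelder : hoelder_continuous bump.
Proof.
exists eps^-1, 1; split; rewrite ?ltr01 ?lexx ?invr_ge0 ?ltW// => x y.
by rewrite powRr1 ?mdist_ge0// bump_lipschitz.
Qed.

(** Supplies the closed set through which the open set [U] is shown to have full measure. *)
Lemma absorbing_closure : closure (h @` U) `<=` U.
Proof.
move=> z /(_ _ (nbhsx_ballx z _ eps_gt0))[_ [[u Uu <-]]].
by rewrite ballEmdist /= metric_sym => /(absorbing Uu).
Qed.

Lemma absorbing_preimage : U `<=` h @^-1` U.
Proof. by move=> z Uz; apply: (absorbing Uz); rewrite mdistxx. Qed.

Variables (g : X -> X) (mu : probability (borel X) R).
Hypotheses (ch : continuous h) (cg : continuous g).
Hypotheses (hg : cancel h g) (gh : cancel g h) (oU : open U).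
Hypothesis hinv : invariant_measure mu h.

Let preim (k : X -> X) : continuous k -> open (k @^-1` U).
Proof. by move=> ck; apply: open_comp => // x _; exact: ck. Qed.

Lemma null_setD (A B : set (borel X)) : measurable A -> measurable B ->
  A `<=` B -> mu A = mu B -> mu (B `\` A) = 0%E.
Proof.
move=> mA mB AB E; have BA : B `&` A = A by apply/setIidPr.
transitivity (mu B - mu A)%E; last by rewrite -E subee// fin_num_measure.
by rewrite measureD ?BA// ltey_eq fin_num_measure.
Qed.

(** [U] lies in its preimage and has the same mass, so almost no point enters [U] from outside. *)
Lemma null_escape : mu (h @^-1` U `\` U) = 0%E.
Proof.
apply: null_setD; [exact: open_borel|exact: (open_borel (preim (@ch)))|exact: absorbing_preimage|].
by rewrite hinv//; exact: open_borel.
Qed.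

Lemma integral_bump (t : R) :
  (\int[mu]_x (t * bump x)%:E = (t * fine (mu (~` U)))%:E)%E.
Proof.
have mU : measurable (U : set (borel X)) by exact: open_borel.
have mUC : measurable (~` U : set (borel X)) by exact: measurableC.
have mgU : measurable (g @^-1` U : set (borel X)) by exact: (open_borel (preim (@cg))).
(* The preimage of [U] under [g] is its image under [h]; it lies in [U] with the same mass, so the
   bump vanishes almost everywhere on [U]. *)
have N0 : mu (U `\` g @^-1` U) = 0%E.
  apply: null_setD => //; first by move=> z /absorbing_preimage /=; rewrite gh.
  rewrite -hinv//; congr (mu _).
  by apply/seteqP; split => z /=; rewrite hg.
rewrite (@ae_eq_integral _ _ _ mu setT (fun x => t%:E * (\1_(~` U) x)%:E)%E)//.
- rewrite integralZl//; last exact: integrable_indic.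
  by rewrite integral_indic// setIT EFinM fineK// fin_num_measure.
- apply/measurable_EFinP; apply: measurable_funM => //.
  apply: continuous_borel_real; apply: lipschitz_continuous bump_lipschitz.
  by rewrite invr_gt0.
- under eq_fun do rewrite -EFinM.
  by apply/measurable_EFinP; apply: measurable_funM.
- exists (U `\` g @^-1` U); split => //; first exact: measurableD.
  move=> x /= /not_implyP[_ ne]; apply: contrapT => nx; apply: ne.
  rewrite -EFinM indicE; have [Ux|Ux] := pselect (U x); last first.
    by rewrite mem_set// bump_setC.
  rewrite memNset; last by apply.
  have Ugx : U (g x) by apply: contrapT => Ugx; exact: nx.
  by rewrite -[x]gh bump_image.
Qed.

End bump.

(** * Points reachable by chains *)

Lemma tc_chain (X : Type) (E : X -> X -> Prop) (x z : X) :
  Relation_Operators.clos_trans_n1 X E x z ->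
  exists (n : nat) (u : nat -> X), [/\ (0 < n)%N, u 0%N = x, u n = z &
    forall i, (i < n)%N -> E (u i) (u i.+1)].
Proof.
elim=> {z} [z xz|w z wz _ [n [u [n0 u0 un uE]]]].
  by exists 1%N, (fun i => if i is 0%N then x else z); split => // -[].
exists n.+1, (fun i => if (i <= n)%N then u i else z); split => //.
  by rewrite ltnn.
move=> i; rewrite ltnS => ni; rewrite ni; have [i_n|ni'] := ltnP i n.
  exact: uE.
by rewrite (_ : i = n) ?un//; apply/eqP; rewrite eqn_leq ni.
Qed.

(** Only the last step has to be perturbed, which is why the closure is taken in the form that
    appends steps at the end. *)
Lemma open_tc (R : realType) (X : metricType R) (E : X -> X -> Prop) (x : X) :
  (forall w z, E w z -> \forall z' \near z, E w z') ->
  open [set z | Relation_Operators.clos_trans_n1 X E x z].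
Proof.
move=> oE; rewrite openE => z; case=> {z} [z xz|w z wz xw].
  by apply: filterS (oE _ _ xz) => z' ?; exact: Relation_Operators.tn1_step.
by apply: filterS (oE _ _ wz) => z' wz'; exact: Relation_Operators.tn1_trans wz' xw.
Qed.

Lemma near_mdist_lt (R : realType) (X : metricType R) (p z : X) (eps : R) :
  mdist p z < eps -> \forall z' \near z, mdist p z' < eps.
Proof.
move=> pz; have d0 : 0 < eps - mdist p z by rewrite subr_gt0.
apply: filterS (nbhsx_ballx z _ d0) => z'; rewrite ballEmdist /= ltrBrDl.
exact: le_lt_trans (metric_triangle _ _ _).
Qed.

(** * Homeomorphisms that are not chain-transitive *)

Section nonrecurrent_homeo.
Context (R : realType) (X : pmetricType R) (f g : X -> X).
Hypotheses (Xcompact : compact [set: X]) (cf : continuous f) (cg : continuous g).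
Hypotheses (fg : cancel f g) (gf : cancel g f).
Hypothesis hf : (@htop R X f < +oo)%E.

Lemma homeo_phase_transition : ~ chain_transitive f ->
  exists phi : X -> R, hoelder_continuous phi /\
    ~ real_analytic (fun t : R => fine (pressure f (fun x => t * phi x))).
Proof.
move=> /existsNP[x /existsNP[y /existsNP[e /not_implyP[e0 nochain]]]].
pose E w z := mdist (f w) z < e.
(* The closure is transitive but not reflexive, since a chain has at least one step. *)
pose U := [set z | Relation_Operators.clos_trans_n1 X E x z].
have oU : open U by apply: open_tc => w z; exact: near_mdist_lt.
have absU u z : U u -> mdist (f u) z < e -> U z.
  by move=> Uu uz; exact: Relation_Operators.tn1_trans uz Uu.
have Uy : ~ U y by move=> Uy; apply: nochain; exact: tc_chain Uy.
have Ufx : U (f x).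
  by apply: Relation_Operators.tn1_step; rewrite /E mdistxx.
have U0 : U !=set0 by exists (f x).
have fU := absorbing_preimage e0 absU.
have mf := continuous_borel cf.
have mU : measurable (U : set (borel X)) by exact: open_borel.
have mfU : measurable (f @^-1` U : set (borel X)).
  by rewrite -[_ @^-1` _]setTI; exact: mf.
exists (bump f U e); split; first exact: bump_hoelder.
have cond (mu : probability (borel X) R) (V : set (borel X)) (mV : measurable V) : invariant_measure mu f ->
    mu V != 0%E -> (forall z, ~ (f @^-1` U `\` U) z -> V z <-> V (f z)) ->
    invariant_measure (conditional mu mV) f.
  move=> finv V0 VN; apply: (@conditional_invariant R _ (borel X) mu V (f @^-1` U `\` U) mV f mf
    finv V0 _ _ VN); first exact: measurableD.
  exact: (@null_escape R X f U e e0 absU mu cf oU finv).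
have stepU z : ~ (f @^-1` U `\` U) z -> U z <-> U (f z).
  move=> nz; split => [/fU//|Ufz]; apply: contrapT => Uz; exact: nz.
apply: (@pressure_not_analytic R _ (borel X) f
  [set mu : probability (borel X) R | invariant_measure mu f] U (bump f U e)
  (fine (@htop R X f) + ln 2 + 1) mf _ _ mU).
- by [].
- by move=> mu finv; exact: metric_entropy_le_htop.
- by move=> mu finv U0'; exact: cond.
- move=> mu finv U0'; apply: cond => // z /stepU; exact: not_iff_compat.
- move=> mu t finv; exact: (@integral_bump R X f U e e0 U0 absU g mu cg fg gf oU finv t).
(* From its first iterate on, the orbit of [f x] stays in the image of [U]. *)
- have [mu [finv mu1 _]] := homeo_invariant_measure (f x) Xcompact cf cg fg gf.
  exists mu => //; rewrite probability_setC// (mu1 (closure (f @` U)) U) ?subee//.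
  + move=> n; apply: subset_closure; exists (iter n f (f x)) => //.
    by elim: n => [|n IH] //; exact: fU.
  + exact: closed_closure.
  + exact: absorbing_closure e0 absU.
(* The backward orbit of [y] avoids [U], because [U] is forward invariant and misses [y]. The
   measure is built for [g] and is then invariant under [f] too. *)
- have [mu [ginv _ mu0]] := homeo_invariant_measure y Xcompact cg cf gf fg.
  exists mu.
    move=> A mA; rewrite -ginv; last by rewrite -[_ @^-1` _]setTI; exact: mf.
    by congr (mu _); apply/seteqP; split => z /=; rewrite gf.
  rewrite probability_setC// (mu0 U) ?sube0//.
  suff nU n : ~ U (iter n g y) by move=> n; exact: nU.
  elim: n => [//|n IH] Ugn; apply: IH.
  by rewrite -[iter n g y]gf; exact: fU Ugn.
Qed.

End nonrecurrent_homeo.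

(** * Flows that are not chain-transitive *)

Section nonrecurrent_flow.
Context (R : realType) (X : pmetricType R) (psi : R -> X -> X).
Hypotheses (Xcompact : compact [set: X]) (psiflow : continuous_flow psi).
Hypothesis hpsi : (flow_htop psi < +oo)%E.

(** Lets the construction along forward orbits be applied to the backward orbit of an unreachable
    point. *)
Lemma reverse_flow : continuous_flow (fun t => psi (- t)).
Proof.
have [cpsi psi0 psiD] := psiflow; split.
- move=> [t y]; apply: (@continuous_comp _ _ _ (fun p : R * X => (- p.1, p.2))
    (fun p => psi p.1 p.2)); last exact: cpsi.
  move=> P [[A B] /= [At By] AB].
  have nA : - s @[s --> t] --> - t by exact: cvgN.
  by exists (-%R @^-1` A, B) => /=; [split => //; exact: nA|move=> [s z] [/= As Bz]; exact: (AB (- s, z))].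
- by move=> y; rewrite oppr0.
- by move=> s t y; rewrite opprD psiD.
Qed.

(* The times leaving [nu] invariant form a group. *)
Lemma invariant_of_large_times (nu : probability (borel X) R) (T : R) :
  (forall t, T <= t -> invariant_measure nu (psi t)) ->
  forall t, invariant_measure nu (psi t).
Proof.
have [_ _ psiD] := psiflow; move=> inv t A mA.
have mtA : measurable (psi t @^-1` A : set (borel X)).
  by rewrite -[_ @^-1` _]setTI; exact: (continuous_borel (@continuous_flow_time _ _ _ psiflow t)).
have Ts : T <= T + `|t| by rewrite lerDl.
have Tst : T <= T + `|t| + t by have := ler_norm (- t); rewrite normrN; lra.
transitivity (nu (psi (T + `|t|) @^-1` (psi t @^-1` A))).
  by apply/esym; exact: (inv _ Ts _ mtA).
transitivity (nu (psi (T + `|t| + t) @^-1` A)); last exact: (inv _ Tst _ mA).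
by congr (nu _); apply/seteqP; split => z /=; rewrite (psiD (T + `|t|) t).
Qed.

Lemma flow_phase_transition : ~ flow_chain_transitive psi ->
  exists phi : X -> R, hoelder_continuous phi /\
    ~ real_analytic (fun t : R => fine (flow_pressure psi (fun x => t * phi x))).
Proof.
have [_ psi0 psiD] := psiflow.
move=> /existsNP[x /existsNP[y /existsNP[e /existsNP[T]]]].
move=> /not_implyP[e0 /not_implyP[T0 nochain]].
(* A step may last any time from [T] on, so [U] is absorbing for all these [psi t] with the same gap
   [e]. *)
pose E w z := exists2 t, T <= t & mdist (psi t w) z < e.
pose U := [set z | Relation_Operators.clos_trans_n1 X E x z].
have oU : open U.
  by apply: open_tc => w z [t Tt wz]; apply: filterS (near_mdist_lt wz) => z' ?; exists t.
have absU t u z : T <= t -> U u -> mdist (psi t u) z < e -> U z.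
  by move=> Tt Uu uz; apply: Relation_Operators.tn1_trans Uu; exists t.
have Uy : ~ U y.
  move=> Uy; have [n [u [n0 u0 un uE]]] := tc_chain Uy; apply: nochain; exists n, u.
  (* The sequence of times must be total; 0 is a placeholder beyond the chain. *)
  have /choice[t tE] : forall i, exists t, (i < n)%N -> T <= t /\ mdist (psi t (u i)) (u i.+1) < e.
    move=> i; have [/uE[t Tt ut]|_] := ltnP i n; last by exists 0.
    by exists t.
  by exists t.
have Ux : U (psi T x).
  by apply: Relation_Operators.tn1_step; exists T => //; rewrite mdistxx.
have U0 : U !=set0 by exists (psi T x).
have fU t : T <= t -> U `<=` psi t @^-1` U.
  by move=> Tt; apply: (absorbing_preimage e0) => u z; exact: absU.
have mpsi t := continuous_borel (@continuous_flow_time _ _ _ psiflow t).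
have mU : measurable (U : set (borel X)) by exact: open_borel.
have mpU t : measurable (psi t @^-1` U : set (borel X)).
  by rewrite -[_ @^-1` _]setTI; exact: mpsi.
have absT u z : U u -> mdist (psi T u) z < e -> U z by exact: absU.
exists (bump (psi T) U e); split; first exact: bump_hoelder.
have cond (mu : probability (borel X) R) (V : set (borel X)) (mV : measurable V) :
    (forall t, invariant_measure mu (psi t)) -> mu V != 0%E ->
    (forall t z, ~ (psi t @^-1` U `\` U) z -> T <= t -> V z <-> V (psi t z)) ->
    forall t, invariant_measure (conditional mu mV) (psi t).
  move=> pinv V0 VN.
  (* The exceptional set depends on [t] and is shown to be null for [t >= T]; the other times
     follow. *)
  apply: (@invariant_of_large_times _ T) => t Tt.
  apply: (@conditional_invariant R _ (borel X) mu V (psi t @^-1` U `\` U) mV (psi t)) => //.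
  - exact: measurableD.
  - have abst u z : U u -> mdist (psi t u) z < e -> U z by exact: absU.
    exact: (@null_escape R X (psi t) U e e0 abst mu (@continuous_flow_time _ _ _ psiflow t) oU (pinv t)).
  - by move=> z nz; exact: VN.
have stepU t z : ~ (psi t @^-1` U `\` U) z -> T <= t -> U z <-> U (psi t z).
  move=> nz Tt; split => [/(fU t Tt)//|Ufz]; apply: contrapT => Uz; exact: nz.
(* Entropy is that of [psi 1] whereas the potential comes from [psi T]; the two meet only in the
   measures, which are invariant under both. *)
apply: (@pressure_not_analytic R _ (borel X) (psi 1)
  [set mu : probability (borel X) R | forall t, invariant_measure mu (psi t)] U (bump (psi T) U e)
  (fine (@htop R X (psi 1)) + ln 2 + 1) (mpsi 1) _ _ mU).
- by move=> mu; apply.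
- move=> mu pinv; apply: metric_entropy_le_htop => //.
  exact: continuous_flow_time.
- by move=> mu pinv U0'; exact: cond.
- move=> mu pinv U0'; apply: cond => // t z nz Tt.
  exact: not_iff_compat (stepU t z nz Tt).
- move=> mu t pinv.
  exact: (@integral_bump R X (psi T) U e e0 U0 absT (psi (- T)) mu
    (@continuous_flow_time _ _ _ psiflow (- T)) (flowK psiflow T) (flowNK psiflow T) oU (pinv T) t).
- have [mu [pinv mu1 _]] := flow_invariant_measure (psi T x) Xcompact psiflow.
  (* One [T] ensures that the orbit is in [U], a second one that it is in the image of [U] under
     [psi T]. *)
  exists mu => //; rewrite probability_setC// (mu1 (closure (psi T @` U)) U (T + T)) ?subee//.
  + move=> t Tt; apply: subset_closure; exists (psi (t - T) (psi T x)).
      by apply: fU Ux; lra.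
    by rewrite -psiD subrK.
  + exact: closed_closure.
  + exact: absorbing_closure e0 absT.
- have [mu [pinv _ mu0]] := flow_invariant_measure y Xcompact reverse_flow.
  exists mu; first by move=> t; rewrite -[t]opprK; exact: pinv.
  rewrite probability_setC// (mu0 U T) ?sube0// => t Tt Ut; apply: Uy.
  by rewrite -(flowNK psiflow t y); exact: fU Ut.
Qed.

End nonrecurrent_flow.

Theorem theorem1 (R : realType) (X : pmetricType R)
    (f : X -> X) (psi : R -> X -> X)
    (Xcompact : compact [set: X])
    (fhomeo : homeomorphism f)
    (psiflow : continuous_flow psi)
    (hf : (@htop R X f < +oo)%E)
    (hpsi : (flow_htop psi < +oo)%E) :
  (~ chain_transitive f ->
     exists phi : X -> R, hoelder_continuous phi /\
       ~ real_analytic (fun t : R => fine (pressure f (fun x => t * phi x))))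
  /\
  (~ flow_chain_transitive psi ->
     exists phi : X -> R, hoelder_continuous phi /\
       ~ real_analytic (fun t : R => fine (flow_pressure psi (fun x => t * phi x)))).
Proof.
have [cf [g [cg fg gf]]] := fhomeo; split.
  exact: (homeo_phase_transition Xcompact cf cg fg gf hf).
exact: flow_phase_transition.
Qed.
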